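(* Let $A$ be a normal noetherian domain such that the complement of every hypersurface in $\operatorname{Spec} A$ is affine. Then the complement of every hypersurface in $\operatorname{Spec} A[T]$ is also affine.
   Context: A hypersurface is a closed subset of pure codimension one, i.e. the support of an effective Weil divisor. $A[T]$ is the polynomial ring in one variable. *)

(* Defs.v *)
From HB Require Import structures.
From mathcomp Require Import all_boot all_order all_algebra.
From mathcomp Require Import generic_quotient fraction mxpoly.
From mathcomp Require Import ring.
From mathcomp Require Import mathcomp_extra boolp classical_sets topology.

Set Implicit Arguments.
Unset Strict Implicit.
Unset Printing Implicit Defensive.

Import GRing.Theory.
Local Open Scope classical_set_scope.
Local Open Scope ring_scope.
Local Open Scope quotient_scope.

(* Ideals are Prop-valued and not assumed proper, unlike those of              *)
(* ring_quotient, which are boolean, proper, and need a nonzero ring.          *)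
Definition ideal (R : comPzRingType) (I : set R) : Prop :=
  [/\ I 0, forall x y, I x -> I y -> I (x + y)
    & forall a x, I x -> I (a * x)].

Definition prime_ideal (R : comPzRingType) (P : set R) : Prop :=
  [/\ ideal P, ~ P 1 & forall x y, P (x * y) -> P x \/ P y].

Definition ideal_span (R : comPzRingType) (s : seq R) : set R :=
  [set x | exists c : 'I_(size s) -> R, x = \sum_(i < size s) c i * s`_i].

Definition noetherian (R : comPzRingType) : Prop :=
  forall I : set R, ideal I -> exists s : seq R, I = ideal_span s.

Definition normal_domain (R : idomainType) : Prop :=
  forall z : {fraction R},
    integralOver (@tofrac R) z -> exists a : R, z = tofrac a.

Section Topology.
Variable X : topologicalType.
Implicit Types Z H : set X.

Definition irreducible Z : Prop :=
  Z !=set0 /\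
  forall F G, closed F -> closed G -> Z `<=` F `|` G -> Z `<=` F \/ Z `<=` G.

Definition irreducible_component H Z : Prop :=
  [/\ irreducible Z, Z `<=` H
    & forall Z', irreducible Z' -> Z' `<=` H -> Z `<=` Z' -> Z' = Z].

(* Chains Z = C 0 < C 1 < ... < C n of irreducible closed subsets.             *)
Definition irreducible_chain Z (n : nat) : Prop :=
  exists C : nat -> set X,
    [/\ C 0%N = Z,
        forall i, (i <= n)%N -> closed (C i) /\ irreducible (C i)
      & forall i, (i < n)%N -> C i `<` C i.+1].

Definition codim_eq Z (n : nat) : Prop :=
  irreducible_chain Z n /\ ~ irreducible_chain Z n.+1.

(* The empty set, the support of the zero divisor, is included.                *)
Definition hypersurface H : Prop :=
  closed H /\ forall Z, irreducible_component H Z -> codim_eq Z 1.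

End Topology.

Record spec (R : comPzRingType) := Spec {
  prime_set : set R;
  prime_setP : prime_ideal prime_set }.

HB.instance Definition _ (R : comPzRingType) := gen_eqMixin (spec R).
HB.instance Definition _ (R : comPzRingType) := gen_choiceMixin (spec R).

Section Zariski.
Variable R : comPzRingType.

Definition zeros (E : set R) : set (spec R) := [set p | E `<=` prime_set p].

Definition zariski_open (U : set (spec R)) : Prop :=
  exists E, U = ~` zeros E.

Lemma zariski_openT : zariski_open setT.
Proof.
exists setT; apply/seteqP; split=> // p _ /= pT.
by case: (prime_setP p) => _ + _; apply; exact: pT.
Qed.

Lemma zariski_openI U V :
  zariski_open U -> zariski_open V -> zariski_open (U `&` V).
Proof.
move=> [E ->] [F ->].
exists [set z | exists x y, [/\ E x, F y & z = x * y]].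
apply/seteqP; split=> p /=.
  move=> [nE nF] EF; apply: nE => x Ex; apply: contrapT => npx.
  apply: nF => y Fy; case: (prime_setP p) => _ _ /(_ x y) [] //.
  by apply: EF; exists x, y.
have [[_ _ pM] _ _] := prime_setP p.
move=> nEF; split=> sub; apply: nEF => _ [x [y [Ex Fy ->]]].
  by rewrite mulrC; apply: pM; exact: sub.
by apply: pM; exact: sub.
Qed.

Lemma zariski_open_bigU (I : Type) (f : I -> set (spec R)) :
  (forall i, zariski_open (f i)) -> zariski_open (\bigcup_i f i).
Proof.
move=> fo; pose E i := projT1 (cid (fo i)).
have fE i : f i = ~` zeros (E i) by rewrite /E; case: cid.
exists (\bigcup_i E i); apply/seteqP; split=> p /=.
  move=> [i _]; rewrite fE => nE sub; apply: nE => x Ex.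
  by apply: sub; exists i.
move=> nE; apply: contrapT => nU; apply: nE => x [i _ Ex].
apply: contrapT => npx; apply: nU; exists i => //.
by rewrite fE => /(_ x Ex).
Qed.

End Zariski.

HB.instance Definition _ (R : comPzRingType) :=
  isOpenTopological.Build (spec R)
    (@zariski_openT R) (@zariski_openI R) (@zariski_open_bigU R).

(* The localization of R at a prime p, i.e. the stalk of the structure sheaf   *)
(* of Spec R at p.                                                             *)
Section Stalk.
Variables (R : comPzRingType) (p : spec R).

Definition denom := {s : R | `[< ~ prime_set p s >]}.

Lemma denom1P : `[< ~ prime_set p 1 >].
Proof. by apply/asboolP; case: (prime_setP p). Qed.

Lemma denomMP (s t : denom) : `[< ~ prime_set p (sval s * sval t) >].
Proof.
apply/asboolP; case: (prime_setP p) => _ _ pP /pP [].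
- exact/asboolP/(proj2_sig s).
- exact/asboolP/(proj2_sig t).
Qed.

Definition denom1 : denom := exist _ 1 denom1P.
Definition denomM (s t : denom) : denom := exist _ (sval s * sval t) (denomMP s t).

Definition prefrac : Type := (R * denom)%type.
HB.instance Definition _ := Choice.on prefrac.

Definition fracrel (x y : prefrac) : bool :=
  `[< exists u : denom,
        sval u * (x.1 * sval y.2) = sval u * (y.1 * sval x.2) >].

Lemma fracrel_refl : reflexive fracrel.
Proof. by move=> x; apply/asboolP; exists denom1. Qed.

Lemma fracrel_sym : symmetric fracrel.
Proof. by move=> x y; apply/asboolP/asboolP => -[u uP]; exists u. Qed.

Lemma fracrel_trans : transitive fracrel.
Proof.
move=> y x z /asboolP[u uP] /asboolP[v vP]; apply/asboolP.
exists (denomM (denomM u v) y.2) => /=.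
transitivity (sval u * (x.1 * sval y.2) * (sval v * sval z.2)); first by ring.
rewrite uP; transitivity (sval v * (y.1 * sval z.2) * (sval u * sval x.2)).
  by ring.
by rewrite vP; ring.
Qed.

Canonical fracrel_equiv := EquivRel fracrel fracrel_refl fracrel_sym fracrel_trans.

Definition stalk := {eq_quot fracrel}.
HB.instance Definition _ : EqQuotient _ fracrel stalk := EqQuotient.on stalk.
HB.instance Definition _ := Choice.on stalk.

Definition mkfrac (a : R) (s : denom) : stalk := \pi_stalk ((a, s) : prefrac).

Lemma frac_eqP a s b t :
  mkfrac a s = mkfrac b t <->
  exists u : denom, sval u * (a * sval t) = sval u * (b * sval s).
Proof. by split=> [/eqmodP/asboolP|uP]; [|apply/eqmodP/asboolP]. Qed.

Lemma fracP (x : stalk) : exists a s, x = mkfrac a s.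
Proof. by elim/quotW: x => -[a s]; exists a, s. Qed.

Definition stalk_add (x y : stalk) : stalk :=
  let: (a, s) := repr x in let: (b, t) := repr y in
  mkfrac (a * sval t + b * sval s) (denomM s t).
Definition stalk_opp (x : stalk) : stalk :=
  let: (a, s) := repr x in mkfrac (- a) s.
Definition stalk_mul (x y : stalk) : stalk :=
  let: (a, s) := repr x in let: (b, t) := repr y in
  mkfrac (a * b) (denomM s t).

Lemma frac_repr a s : exists u : denom,
  sval u * ((repr (mkfrac a s)).1 * sval s)
  = sval u * (a * sval (repr (mkfrac a s)).2).
Proof.
apply/frac_eqP; rewrite -[RHS]reprK /mkfrac.
by case: (repr _).
Qed.

Lemma stalk_addE a s b t :
  stalk_add (mkfrac a s) (mkfrac b t) =
  mkfrac (a * sval t + b * sval s) (denomM s t).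
Proof.
have [u] := frac_repr a s; have [v] := frac_repr b t.
rewrite /stalk_add; case: (repr (mkfrac a s)) (repr (mkfrac b t)) => [a' s'] [b' t'] /= vP uP.
apply/frac_eqP; exists (denomM u v) => /=.
transitivity (sval u * (a' * sval s) * (sval v * sval t * sval t')
  + sval v * (b' * sval t) * (sval u * sval s * sval s')); first by ring.
by rewrite uP vP; ring.
Qed.

Lemma stalk_oppE a s : stalk_opp (mkfrac a s) = mkfrac (- a) s.
Proof.
have [u] := frac_repr a s.
rewrite /stalk_opp; case: (repr _) => [a' s'] /= uP.
by apply/frac_eqP; exists u; rewrite !mulNr !mulrN uP.
Qed.

Lemma stalk_mulE a s b t :
  stalk_mul (mkfrac a s) (mkfrac b t) = mkfrac (a * b) (denomM s t).
Proof.
have [u] := frac_repr a s; have [v] := frac_repr b t.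
rewrite /stalk_mul; case: (repr (mkfrac a s)) (repr (mkfrac b t)) => [a' s'] [b' t'] /= vP uP.
apply/frac_eqP; exists (denomM u v) => /=.
transitivity (sval u * (a' * sval s) * (sval v * (b' * sval t))); first by ring.
by rewrite uP vP; ring.
Qed.

Let frac_eq a s b t : a * sval t = b * sval s -> mkfrac a s = mkfrac b t.
Proof. by move=> e; apply/frac_eqP; exists denom1; rewrite e. Qed.

Lemma stalk_addA : associative stalk_add.
Proof.
move=> x y z; have [a [s ->]] := fracP x; have [b [t ->]] := fracP y.
have [c [r ->]] := fracP z; rewrite !stalk_addE; apply: frac_eq => /=.
by ring.
Qed.

Lemma stalk_addC : commutative stalk_add.
Proof.
move=> x y; have [a [s ->]] := fracP x; have [b [t ->]] := fracP y.
by rewrite !stalk_addE; apply: frac_eq => /=; ring.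
Qed.

Lemma stalk_add0 : left_id (mkfrac 0 denom1) stalk_add.
Proof.
move=> x; have [a [s ->]] := fracP x.
by rewrite !stalk_addE; apply: frac_eq => /=; ring.
Qed.

Lemma stalk_addN : left_inverse (mkfrac 0 denom1) stalk_opp stalk_add.
Proof.
move=> x; have [a [s ->]] := fracP x.
by rewrite stalk_oppE stalk_addE; apply: frac_eq => /=; ring.
Qed.

Lemma stalk_mulA : associative stalk_mul.
Proof.
move=> x y z; have [a [s ->]] := fracP x; have [b [t ->]] := fracP y.
have [c [r ->]] := fracP z; rewrite !stalk_mulE; apply: frac_eq => /=.
by ring.
Qed.

Lemma stalk_mulC : commutative stalk_mul.
Proof.
move=> x y; have [a [s ->]] := fracP x; have [b [t ->]] := fracP y.
by rewrite !stalk_mulE; apply: frac_eq => /=; ring.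
Qed.

Lemma stalk_mul1 : left_id (mkfrac 1 denom1) stalk_mul.
Proof.
move=> x; have [a [s ->]] := fracP x.
by rewrite !stalk_mulE; apply: frac_eq => /=; ring.
Qed.

Lemma stalk_mulD : left_distributive stalk_mul stalk_add.
Proof.
move=> x y z; have [a [s ->]] := fracP x; have [b [t ->]] := fracP y.
have [c [r ->]] := fracP z.
by rewrite stalk_addE !stalk_mulE stalk_addE; apply: frac_eq => /=; ring.
Qed.

HB.instance Definition _ :=
  GRing.isZmodule.Build stalk stalk_addA stalk_addC stalk_add0 stalk_addN.
HB.instance Definition _ :=
  GRing.Zmodule_isComPzRing.Build stalk
    stalk_mulA stalk_mulC stalk_mul1 stalk_mulD.

End Stalk.

(* Sections of the structure sheaf of Spec R: functions assigning to each p in *)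
(* U an element of the stalk at p, locally given by a single fraction a / s.   *)
(* The definition makes sense for every set U but is only meant for open ones. *)
Section Sections.
Variables (R : comPzRingType) (U : set (spec R)).

Definition germs := forall p : spec R, U p -> stalk p.

Definition locally_fraction (f : germs) : Prop :=
  forall p, U p -> exists V : set (spec R),
    [/\ open V, V p & exists a s : R, forall q (Uq : U q), V q ->
       exists sq : `[< ~ prime_set q s >],
         f q Uq = mkfrac a (exist _ s sq : denom q)].

Record sections := Sections {
  germ : germs;
  germP : locally_fraction germ }.

HB.instance Definition _ := gen_eqMixin sections.
HB.instance Definition _ := gen_choiceMixin sections.

Lemma sections_eq (f g : sections) :
  (forall p (Up : U p), germ f Up = germ g Up) -> f = g.
Proof.
case: f g => [f fP] [g gP] /= fg.
have e : f = g.
  by apply: functional_extensionality_dep => p;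
     apply: functional_extensionality_dep => Up.
by rewrite e in fP *; congr Sections; exact: Prop_irrelevance.
Qed.

Lemma sections_cst_subproof (a : R) :
  locally_fraction (fun p _ => mkfrac a (denom1 p)).
Proof.
move=> p Up; exists setT; split=> //; first exact: openT.
by exists a, 1 => q Uq _; exists (denom1P q).
Qed.
Definition sections_cst a := Sections (sections_cst_subproof a).

Lemma sections_opp_subproof (f : sections) :
  locally_fraction (fun p Up => - germ f Up).
Proof.
move=> p Up; have [V [oV Vp [a [s fV]]]] := germP f Up.
exists V; split=> //; exists (- a), s => q Uq Vq.
by have [sq ->] := fV q Uq Vq; exists sq; exact: stalk_oppE.
Qed.
Definition sections_opp f := Sections (sections_opp_subproof f).

Lemma sections_add_subproof (f g : sections) :
  locally_fraction (fun p Up => germ f Up + germ g Up).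
Proof.
move=> p Up; have [V [oV Vp [a [s fV]]]] := germP f Up.
have [W [oW Wp [b [t gW]]]] := germP g Up.
exists (V `&` W); split=> //; first exact: openI.
exists (a * t + b * s), (s * t) => q Uq [Vq Wq].
have [sq ->] := fV q Uq Vq; have [tq ->] := gW q Uq Wq.
exists (denomMP (exist _ s sq : denom q) (exist _ t tq : denom q)).
exact: stalk_addE.
Qed.
Definition sections_add f g := Sections (sections_add_subproof f g).

Lemma sections_mul_subproof (f g : sections) :
  locally_fraction (fun p Up => germ f Up * germ g Up).
Proof.
move=> p Up; have [V [oV Vp [a [s fV]]]] := germP f Up.
have [W [oW Wp [b [t gW]]]] := germP g Up.
exists (V `&` W); split=> //; first exact: openI.
exists (a * b), (s * t) => q Uq [Vq Wq].
have [sq ->] := fV q Uq Vq; have [tq ->] := gW q Uq Wq.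
exists (denomMP (exist _ s sq : denom q) (exist _ t tq : denom q)).
exact: stalk_mulE.
Qed.
Definition sections_mul f g := Sections (sections_mul_subproof f g).

Lemma sections_addA : associative sections_add.
Proof. by move=> f g h; apply: sections_eq => p Up /=; exact: addrA. Qed.
Lemma sections_addC : commutative sections_add.
Proof. by move=> f g; apply: sections_eq => p Up /=; exact: addrC. Qed.
Lemma sections_add0 : left_id (sections_cst 0) sections_add.
Proof. by move=> f; apply: sections_eq => p Up /=; exact: add0r. Qed.
Lemma sections_addN : left_inverse (sections_cst 0) sections_opp sections_add.
Proof. by move=> f; apply: sections_eq => p Up /=; exact: addNr. Qed.
Lemma sections_mulA : associative sections_mul.
Proof. by move=> f g h; apply: sections_eq => p Up /=; exact: mulrA. Qed.
Lemma sections_mulC : commutative sections_mul.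
Proof. by move=> f g; apply: sections_eq => p Up /=; exact: mulrC. Qed.
Lemma sections_mul1 : left_id (sections_cst 1) sections_mul.
Proof. by move=> f; apply: sections_eq => p Up /=; exact: mul1r. Qed.
Lemma sections_mulD : left_distributive sections_mul sections_add.
Proof. by move=> f g h; apply: sections_eq => p Up /=; exact: mulrDl. Qed.

HB.instance Definition _ :=
  GRing.isZmodule.Build sections
    sections_addA sections_addC sections_add0 sections_addN.
HB.instance Definition _ :=
  GRing.Zmodule_isComPzRing.Build sections
    sections_mulA sections_mulC sections_mul1 sections_mulD.

End Sections.

Lemma restrict_subproof (R : comPzRingType) (U V : set (spec R))
    (VU : V `<=` U) (f : sections U) :
  locally_fraction (fun p (Vp : V p) => germ f (VU p Vp)).
Proof.
move=> p Vp; have [W [oW Wp [a [s fW]]]] := germP f (VU p Vp).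
by exists W; split=> //; exists a, s => q Vq Wq; exact: fW.
Qed.

Definition restrict (R : comPzRingType) (U V : set (spec R))
    (VU : V `<=` U) (f : sections U) : sections V :=
  Sections (restrict_subproof VU f).

(* An open U of Spec A is affine if (U, O|_U) is isomorphic to (Spec B, O_B)   *)
(* for some commutative ring B (possibly zero, when U is empty).  The          *)
(* isomorphism is given by a homeomorphism f of Spec B onto U and ring         *)
(* isomorphisms phi V : O_A(V) -> O_B(f^-1 V), for V open in U, compatible     *)
(* with restriction.  No condition on stalks is needed: an isomorphism of      *)
(* ringed spaces between locally ringed spaces is one of locally ringed spaces.*)
Definition affine_open (A : comPzRingType) (U : set (spec A)) : Prop :=
  open U /\
  exists (B : comPzRingType) (f : spec B -> spec A)
         (phi : forall V : set (spec A), sections V -> sections (f @^-1` V)),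
    [/\ [/\ injective f, f @` setT = U, continuous f
          & forall W : set (spec B), open W -> open (f @` W)],
        forall V : set (spec A), open V -> V `<=` U ->
          [/\ zmod_morphism (phi V), monoid_morphism (phi V)
            & bijective (phi V)]
      & forall (V W : set (spec A)) (WV : W `<=` V),
          open V -> open W -> V `<=` U ->
          forall g : sections V,
            phi W (restrict WV g) = restrict (preimage_subset WV) (phi V g)].

(* Main.v *)
(* For a domain R with fraction field F and U = D(I), I <> 0, let O(U) be the    *)
(* ring of the x in F that are regular on U. Then U is affine iff I O(U) is     *)
(* the unit ideal.                                                              *)
(* Let H be a hypersurface of Spec A[T] with ideal I, let f in I be nonzero of  *)
(* minimal degree, C = (f : I) and I' = (f : C), so that H = V(I'). By          *)
(* Dedekind's Prague theorem I' = f a[T] for a fractional ideal a of A, and for *)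
(* each coefficient c <> 0 of f the ideal c a of A is divisorial, hence defines *)
(* a hypersurface of Spec A. As its complement is affine, 1 is a combination of *)
(* elements of c a with regular coefficients; multiplying by a large power of   *)
(* c / f turns this into (c / f)^n in I' O(U') with U' = D(I'). Since the       *)
(* coefficients c_i satisfy sum_i (c_i / f) T^i = 1, the ideal I' O(U') is the  *)
(* unit ideal.                                                                  *)

From HB Require Import structures.
Require Import Defs.
From mathcomp Require Import all_boot all_order all_algebra.
From mathcomp Require Import fraction ring.
From mathcomp Require Import boolp classical_sets topology.

Set Implicit Arguments.
Unset Strict Implicit.
Unset Printing Implicit Defensive.

Import GRing.Theory.
Local Open Scope classical_set_scope.
Local Open Scope ring_scope.

(** * Ideals and primes *)

(** Affineness becomes ideal theory: by [affine_complement_unit] and [unit_affine_complement], D(I)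
    with I nonzero is affine exactly when I generates the unit ideal of O(D(I)). So a relation
    expressing 1 has to be carried from Spec A to Spec A[T].

    A normal noetherian domain is completely integrally closed ([noetherian_normal_cic]). This
    yields Dedekind's Prague theorem ([divides_content]), and it makes V((c : Z)) a hypersurface for
    nonzero c ([colon_hypersurface]).

    Let H in Spec A[T] have ideal I, and let f in I satisfy d I inside (f) for a nonzero constant d
    ([ideal_poly_quasi_principal]). A height one prime q containing I is minimal over (f), so q = (f
    : y) by [minimal_prime_colon]. Hence q contains the reflexive hull I' = (f : (f : I)), and H =
    V(I'). For a nonzero coefficient c of f, [residual_factor] and [residual_multiple] together say
    I' = (f / c) a[T] with a a colon ideal of A. The relation expressing 1 through a on D(a),
    multiplied by a power of c / f, puts a power of c / f in I' O(D(I')) ([ratio_radical]). The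
    ratios c / f generate the unit ideal, whence [residual_affine]. *)

Section Ideals.
Variable R : comPzRingType.
Implicit Types (I P : set R) (s : seq R).

Lemma idealN I x : ideal I -> I x -> I (- x).
Proof. by case=> _ _ IM Ix; rewrite -mulN1r; exact: IM. Qed.

Lemma idealB I x y : ideal I -> I x -> I y -> I (x - y).
Proof. by move=> idI Ix Iy; case: (idI) => _ + _; apply=> //; exact: idealN. Qed.

Lemma ideal_sum I (T : Type) (r : seq T) (Q : pred T) (F : T -> R) :
  ideal I -> (forall i, Q i -> I (F i)) -> I (\sum_(i <- r | Q i) F i).
Proof. by case=> I0 ID _ IF; elim/big_ind: _. Qed.

Lemma primeX P x n : prime_ideal P -> P (x ^+ n) -> P x.
Proof.
case=> _ P1 PM; elim: n => [|n IHn]; first by rewrite expr0.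
by rewrite exprS => /PM[].
Qed.

Definition ideal_gen (X : set R) : set R :=
  [set x | forall I, ideal I -> X `<=` I -> I x].

Lemma ideal_genP X : ideal (ideal_gen X).
Proof.
split=> [I [? _ _] _ //|x y Xx Xy I idI XI|a x Xx I idI XI]; case: (idI) => _ ID IM.
- by apply: ID; [exact: Xx|exact: Xy].
- by apply: IM; exact: Xx.
Qed.

Lemma sub_ideal_gen X : X `<=` ideal_gen X.
Proof. by move=> x Xx I _; apply. Qed.

Lemma ideal_span_cons x s y :
  ideal_span (x :: s) y <-> exists a z, ideal_span s z /\ y = a * x + z.
Proof.
split=> [[c ->]|[a [z [[c ->] ->]]]].
  exists (c ord0), (\sum_(i < size s) c (lift ord0 i) * s`_i); split.
    by exists (fun i => c (lift ord0 i)).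
  by rewrite big_ord_recl; congr (_ + _); apply: eq_bigr.
exists (fun i : 'I_(size s).+1 => if unlift ord0 i is Some j then c j else a).
rewrite /= big_ord_recl unlift_none /=; congr (_ + _).
by apply: eq_bigr => i _; rewrite liftK.
Qed.

Lemma ideal_span_nil y : @ideal_span R [::] y <-> y = 0.
Proof.
split=> [[c ->]|->]; first by rewrite big_ord0.
by exists (fun=> 0); rewrite big_ord0.
Qed.

Lemma ideal_spanP s : ideal (ideal_span s).
Proof.
split=> [|x y [c ->] [d ->]|a x [c ->]].
- by exists (fun=> 0); rewrite big1// => i _; rewrite mul0r.
- exists (fun i => c i + d i); rewrite -big_split; apply: eq_bigr => i _ /=.
  by rewrite mulrDl.
- exists (fun i => a * c i); rewrite mulr_sumr; apply: eq_bigr => i _ /=.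
  by rewrite mulrA.
Qed.

Lemma mem_ideal_span s x : x \in s -> ideal_span s x.
Proof.
elim: s => // y s IHs; rewrite inE => /orP[/eqP ->|/IHs xs]; apply/ideal_span_cons.
  by exists 1, 0; split; [case: (ideal_spanP s)|rewrite mul1r addr0].
by exists 0, x; split=> //; rewrite mul0r add0r.
Qed.

Lemma ideal_span_sub s I :
  ideal I -> (forall x, x \in s -> I x) -> ideal_span s `<=` I.
Proof.
move=> idI sI x [c ->]; apply: ideal_sum => // i _; case: (idI) => _ _ IM.
by apply: IM; apply: sI; exact: mem_nth.
Qed.

Lemma ideal_bigcup_chain (F : set (set R)) :
  F !=set0 -> (forall I, F I -> ideal I) -> total_on F subset ->
  ideal (\bigcup_(I in F) I).
Proof.
move=> [I0 FI0] Fid Ftot; split.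
- by exists I0 => //; case: (Fid _ FI0).
- move=> x y [I FI Ix] [J FJ Jy].
  have [IJ|JI] := Ftot _ _ FI FJ.
    by exists J => //; case: (Fid _ FJ) => _ JD _; apply: JD => //; exact: IJ.
  by exists I => //; case: (Fid _ FI) => _ ID _; apply: ID => //; exact: JI.
- by move=> a x [I FI Ix]; exists I => //; case: (Fid _ FI) => _ _; apply.
Qed.

(** Zorn's lemma applies to the members of [C] above [I0] once the empty set is added as the union
    of the empty chain. The empty set is not maximal, since it lies strictly below [I0]. *)
Lemma maximal_ideal_in (C : set (set R)) (I0 : set R) :
  C I0 -> (forall I, C I -> ideal I) ->
  (forall F : set (set R), F !=set0 -> F `<=` C -> total_on F subset ->
     C (\bigcup_(I in F) I)) ->
  exists2 M, C M /\ I0 `<=` M & forall I, C I -> M `<=` I -> I = M.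
Proof.
move=> CI0 Cid Ccup.
have [|M [[M0|[CM IM]] Mmax]] :=
    @Zorn_bigcup R [set I | I = set0 \/ (C I /\ I0 `<=` I)].
- move=> F FC Ftot.
  have [[I [FI [CI II]]]|Fno] := pselect (exists I, F I /\ (C I /\ I0 `<=` I)).
    right; split; last by move=> x /II Ix; exists I.
    rewrite (_ : \bigcup_(I in F) I = \bigcup_(J in F `&` C) J); last first.
      apply/seteqP; split=> x [J]; last by case=> FJ _ Jx; exists J.
      by move=> FJ Jx; exists J => //; split=> //; case: (FC _ FJ) => [J0|[]//];
         rewrite J0 in Jx.
    apply: Ccup; [by exists I|by move=> J []|].
    by move=> J K [FJ _] [FK _]; exact: Ftot.
  left; apply/seteqP; split=> // x [J FJ Jx]; case: (FC _ FJ) => [J0|CJ].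
    by rewrite J0 in Jx.
  by case: Fno; exists J.
- have PI0 : I0 = set0 \/ (C I0 /\ I0 `<=` I0).
    by right; split.
  case: (Mmax I0 _ PI0).
  by case: (Cid _ CI0) => I00 _ _; rewrite M0; split=> // /(_ 0 I00).
exists M => // I CI MI; apply: contrapT => IneM; apply: (Mmax I).
  by split=> // IsubM; apply: IneM; apply/seteqP.
by rewrite /=; right; split=> //; exact: subset_trans MI.
Qed.

(* Krull: an ideal maximal among those avoiding the powers of b is prime.      *)
Lemma prime_avoiding I b : ideal I -> (forall n, ~ I (b ^+ n)) ->
  exists p : spec R, I `<=` prime_set p /\ ~ prime_set p b.
Proof.
move=> idI Ib.
have [||F [J FJ] FC Ftot|M [[idM Mb] IM] Mmax] := @maximal_ideal_in
    [set J | ideal J /\ forall n, ~ J (b ^+ n)] I.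
- by [].
- by move=> J [].
- split; first by apply: ideal_bigcup_chain => //; [exists J|move=> K /FC[]].
  by move=> n [K /FC[_ Kb] /Kb].
have step x : ~ M x -> exists n a m, M m /\ b ^+ n = a * x + m.
  move=> nMx; apply: contrapT => no; apply: nMx.
  pose N := [set y | exists a m, M m /\ y = a * x + m].
  have [M0 MD MM] := idM.
  have idN : ideal N.
    split=> [|y z [a [m [Mm ->]]] [c [k [Mk ->]]]|c y [a [m [Mm ->]]]].
    - by exists 0, 0; split=> //; ring.
    - by exists (a + c), (m + k); split; [exact: MD|ring].
    - by exists (c * a), (c * m); split; [exact: MM|ring].
  rewrite -(Mmax N).
  - by exists 1, 0; split=> //; ring.
  - split=> // n [a [m [Mm E]]]; apply: no; by exists n, a, m.
  - by move=> m Mm; exists 0, m; split=> //; ring.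
have M1 : ~ M 1 by have := Mb 0%N.
have Mprime : prime_ideal M.
  split=> // x y Mxy; apply: contrapT => /not_orP[/step[n [a [m [Mm En]]]]].
  move=> /step[k [c [l [Ml Ek]]]]; apply: (Mb (n + k)%N).
  rewrite exprD En Ek; have [_ MD MM] := idM.
  have -> : (a * x + m) * (c * y + l)
    = (a * c) * (x * y) + ((a * x + m) * l + (c * y) * m) by ring.
  by apply: (MD); [exact: MM|apply: MD; exact: MM].
by exists (Spec Mprime); split=> //; have := Mb 1%N; rewrite expr1.
Qed.

Lemma prime_over I : ideal I -> ~ I 1 -> exists p : spec R, I `<=` prime_set p.
Proof.
move=> idI I1; have [|p [Ip _]] := @prime_avoiding I 1 idI.
  by move=> n; rewrite expr1n.
by exists p.
Qed.

(** Zorn's lemma for reverse inclusion. A chain of primes has a prime intersection: if one member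
    misses [x] and another misses [y], the smaller of them misses both. *)
Lemma minimal_prime I (p : spec R) : I `<=` prime_set p ->
  exists q : spec R, [/\ I `<=` prime_set q, prime_set q `<=` prime_set p
    & forall q' : spec R, I `<=` prime_set q' -> prime_set q' `<=` prime_set q ->
        prime_set q' = prime_set q].
Proof.
move=> Ip.
pose D := [set q : spec R | I `<=` prime_set q /\ prime_set q `<=` prime_set p].
pose T := {q : spec R | D q}.
pose le (q r : T) := `[< prime_set (sval r) `<=` prime_set (sval q) >].
have Dp : D p by split.
have [|||[q [Iq qp]] qmin] := @ZL_preorder T (exist _ p Dp) le.
- by move=> q; apply/asboolP; exact: subset_refl.
- by move=> q r s /asboolP ? /asboolP sr; apply/asboolP; exact: subset_trans sr _.
- move=> F Ftot.
  have [[q0 Fq0]|Fno] := pselect (F !=set0); last first.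
    by exists (exist _ p Dp) => q Fq; case: Fno; exists q.
  pose Q := [set x : R | forall q : T, F q -> prime_set (sval q) x].
  have Qprime : prime_ideal Q.
    split.
    - split=> [q _|x y Qx Qy q Fq|a x Qx q Fq];
        case: (prime_setP (sval q)) => -[q00 qD qM] _ _ //.
        by apply: qD; [exact: Qx|exact: Qy].
      by apply: qM; exact: Qx.
    - by case: (prime_setP (sval q0)) => _ + _ Q1; apply; exact: Q1.
    - move=> x y Qxy; apply: contrapT => /not_orP[nx ny].
      have {nx} [q [Fq qx]] : exists q, F q /\ ~ prime_set (sval q) x.
        apply: contrapT => no; apply: nx => q Fq; apply: contrapT => qx.
        by apply: no; exists q.
      have {ny} [r [Fr ry]] : exists q, F q /\ ~ prime_set (sval q) y.
        apply: contrapT => no; apply: ny => r Fr; apply: contrapT => rx.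
        by apply: no; exists r.
      have [/asboolP rq|/asboolP qr] := Ftot _ _ Fq Fr.
        case: (prime_setP (sval r)) => _ _ /(_ _ _ (Qxy r Fr)) [/rq|] //.
      by case: (prime_setP (sval q)) => _ _ /(_ _ _ (Qxy q Fq)) [|/qr].
  have DQ : D (Spec Qprime).
    split=> /= x; first by move=> Ix q _; have [+ _] := proj2_sig q; apply.
    by move=> /(_ _ Fq0); have [_ +] := proj2_sig q0; apply.
  by exists (exist _ (Spec Qprime) DQ) => q Fq; apply/asboolP => /= x; apply.
exists q; split=> // q' Iq' q'q.
have Dq' : D q' by split=> //; exact: subset_trans q'q qp.
have /asboolP /= qq' : le (exist _ q' Dq') (exist _ q (conj Iq qp)).
  by apply: qmin; apply/asboolP.
by apply/seteqP.
Qed.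

Section PowersOfSpans.
Variables (D : set R) (idD : ideal D).

(** Binomial formula: each term of (a x + z)^(k + m) contains x^k or z^m. The exponent depends on
    the generators only, hence is uniform in [w]. *)
Lemma span_pow s : (forall x, x \in s -> exists n, D (x ^+ n)) ->
  exists n, forall w, ideal_span s w -> D (w ^+ n).
Proof.
have [D0 DD DM] := idD.
elim: s => [_|x s IHs xs].
  by exists 1%N => w /ideal_span_nil ->; rewrite expr1.
have [m Dm] := IHs (fun y ys => xs y (mem_behead (s := x :: s) ys)).
have [k Dk] := xs x (mem_head _ _).
exists (k + m)%N => w /ideal_span_cons[a [z [/Dm Dz ->]]].
rewrite exprDn; apply: ideal_sum => // i _.
rewrite -mulr_natl; apply: (DM).
have [km|mk] := leqP m i.
  by rewrite -(subnK km) exprD mulrA; exact: DM.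
have ki : (k <= k + m - i)%N by rewrite -addnBA ?leq_addr // ltnW.
by rewrite -(subnK ki) exprD mulrC mulrA [_ ^+ k]exprMn; do 2 apply: (DM).
Qed.

End PowersOfSpans.

(** The union of a nonempty chain is finitely generated, so one member of the chain contains all
    generators and equals the union. *)
Lemma noetherian_maximal (C : set (set R)) (I0 : set R) :
  noetherian R -> C I0 -> (forall I, C I -> ideal I) ->
  exists2 M, C M /\ I0 `<=` M & forall I, C I -> M `<=` I -> I = M.
Proof.
move=> noeth CI0 Cid; apply: maximal_ideal_in => // F [J FJ] FC Ftot.
have idU := ideal_bigcup_chain (ex_intro _ J FJ) (fun I FI => Cid I (FC I FI)) Ftot.
have [s Es] := noeth _ idU.
suff [K FK sK] : exists2 K, F K & forall x, x \in s -> K x.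
  rewrite (_ : \bigcup_(I in F) I = K); first exact: FC.
  apply/seteqP; split=> x; last by move=> Kx; exists K.
  by rewrite Es; apply: ideal_span_sub => //; exact/Cid/FC.
have : forall x, x \in s -> (\bigcup_(I in F) I) x.
  by move=> x xs; rewrite Es; exact: mem_ideal_span.
elim: (s) => [|x r IHr] sF; first by exists J.
have [K FK rK] := IHr (fun y yr => sF y (mem_behead (s := x :: r) yr)).
have [L FL Lx] := sF x (mem_head _ _).
have [KL|LK] := Ftot _ _ FK FL.
  by exists L => // y; rewrite inE => /orP[/eqP ->|/rK/KL].
by exists K => // y; rewrite inE => /orP[/eqP ->|/rK //]; exact: LK.
Qed.

(* A minimal prime of I is the annihilator of an element of R / I: it is a     *)
(* maximal element among the (I : y) that are contained in it.                 *)
Lemma minimal_prime_colon I (q : spec R) :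
  noetherian R -> ideal I -> I `<=` prime_set q ->
  (forall q' : spec R, I `<=` prime_set q' -> prime_set q' `<=` prime_set q ->
     prime_set q' = prime_set q) ->
  exists y, forall t, prime_set q t <-> I (t * y).
Proof.
move=> noeth idI Iq qmin; have [I0 ID IM] := idI.
have [qid q1 qM] := prime_setP q.
pose colon y := [set t | I (t * y)].
pose C := [set J | exists y, J = colon y /\ J `<=` prime_set q].
have Cid J : C J -> ideal J.
  move=> [y [-> _]]; split=> [|a b|a b]; rewrite /colon /=; first by rewrite mul0r.
    by rewrite mulrDl; exact: ID.
  by rewrite -mulrA; exact: IM.
have CI : C I.
  by exists 1; split=> //; apply/seteqP; split=> x; rewrite /colon /= mulr1.
have [_ [[y [-> yq]] Iy] ymax] := noetherian_maximal noeth CI Cid.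
have ymaxE z : colon y `<=` colon z -> colon z `<=` prime_set q ->
    colon z = colon y.
  by move=> yz zq; apply: ymax => //; exists z.
have Py : prime_ideal (colon y).
  split; [by apply: Cid; exists y|by move/yq|].
  move=> a b Iab; apply: contrapT => /not_orP[na nb].
  (* If (I : b y) lies in q, maximality makes it equal to (I : y), and it contains a. Otherwise some
     t outside q has t b y in I. Then (I : t y) lies in q because q is prime, so it equals (I : y),
     and it contains b. *)
  have [sub|] := pselect (colon (b * y) `<=` prime_set q).
    apply: na; rewrite -(ymaxE (b * y)) //; last first.
      by move=> x; rewrite /colon /= mulrCA; exact: IM.
    by rewrite /colon /= mulrA.
  move=> /existsNP[t /not_implyP[tb qt]]; apply: nb.
  rewrite -(ymaxE (t * y)).
  - by rewrite /colon /= mulrCA.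
  - by move=> x; rewrite /colon /= mulrCA; exact: IM.
  - move=> x; rewrite /colon /= mulrA => /yq/qM[] //.
exists y => t; rewrite -(qmin (Spec Py)) //=.
Qed.

End Ideals.

(** * Noetherian rings, integral closure and contents *)

Section HilbertBasis.
Variable A : comNzRingType.
Implicit Types (J : set {poly A}) (p q : {poly A}).

Definition coef_at J (n : nat) : set A :=
  [set a | exists p, [/\ J p, (size p <= n.+1)%N & p`_n = a]].

Lemma coef_at_ideal J n : ideal J -> ideal (coef_at J n).
Proof.
move=> [J0 JD JM]; split=> [|_ _ [p [Jp sp <-]] [q [Jq sq <-]]|a _ [p [Jp sp <-]]].
- by exists 0; split; rewrite ?size_poly0 ?coef0.
- exists (p + q); split; [exact: JD| |by rewrite coefD].
  by apply: (leq_trans (size_polyD _ _)); rewrite geq_max sp.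
- exists (a%:P * p); split; [exact: JM| |by rewrite coefCM].
  by rewrite mul_polyC; apply: leq_trans (size_scale_leq _ _) sp.
Qed.

Lemma coef_at_le J m n : ideal J -> (m <= n)%N -> coef_at J m `<=` coef_at J n.
Proof.
move=> [_ _ JM] mn a [p [Jp sp <-]]; exists ('X^(n - m) * p).
split; first exact: JM.
  rewrite mulrC; apply: (leq_trans (size_polyMleq _ _)).
  by rewrite size_polyXn addnS /= -(subnKC mn) -addSn leq_add // subnKC.
by rewrite coefXnM ltnNge leq_subr /= subKn.
Qed.

Lemma poly_size_pred p q n : (size p <= n.+1)%N -> (size q <= n.+1)%N ->
  q`_n = p`_n -> (size (p - q)%R <= n)%N.
Proof.
move=> sp sq E; apply/leq_sizeP => j nj; rewrite coefB.
case: (ltngtP n j) nj => // [nj _|<- _]; last by rewrite E subrr.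
by rewrite !nth_default ?subrr //; [apply: leq_trans sq _|apply: leq_trans sp _].
Qed.

Lemma span_cat (S : comPzRingType) (s t : seq S) :
  ideal_span s `<=` ideal_span (s ++ t) /\ ideal_span t `<=` ideal_span (s ++ t).
Proof.
by split; apply: ideal_span_sub (ideal_spanP _) _ => x xs; apply: mem_ideal_span;
  rewrite mem_cat xs ?orbT.
Qed.

Lemma choice_in (T : eqType) (U : Type) (t : seq T) (P : T -> U -> Prop) (u : U) :
  (forall x, x \in t -> exists y, P x y) ->
  exists f : T -> U, forall x, x \in t -> P x (f x).
Proof.
move=> tP; have [x|f fP] := @choice T U (fun x y => x \in t -> P x y).
  by have [/tP[y Pxy]|nxt] := boolP (x \in t); [exists y|exists u].
by exists f.
Qed.

(** Hilbert's basis theorem. The ideals [coef_at I n] increase with [n]. Lifts of finitely many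
    generators of their union lower the size of any element of size above [M]. Elements of size at
    most [M] are covered by [low], which treats one ideal [coef_at I N] at a time. *)
Lemma noetherian_poly : noetherian A -> noetherian {poly A}.
Proof.
move=> noeth I idI; have [I0 ID IM] := idI.
have low N : exists2 s : seq {poly A}, (forall p, p \in s -> I p)
    & forall p, I p -> (size p <= N)%N -> ideal_span s p.
  elim: N => [|N [s sI sN]].
    exists [::] => // p _; rewrite leqn0 size_poly_eq0 => /eqP ->.
    exact/ideal_span_nil.
  have [t Et] := noeth _ (coef_at_ideal N idI).
  have [|f fP] := @choice_in _ {poly A} t
      (fun a p => [/\ I p, (size p <= N.+1)%N & p`_N = a]) 0.
    by move=> a /mem_ideal_span; rewrite -Et.
  exists (map f t ++ s) => [p|p Ip sp].
    by rewrite mem_cat => /orP[/mapP[a /fP[Ifa _ _] ->]|/sI].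
  have [lt ls] := span_cat (map f t) s.
  have : coef_at I N p`_N by exists p.
  rewrite Et => /(@ideal_span_sub _ t (coef_at (ideal_span (map f t)) N)).
  case=> [|a at_|q [Sq sq Eq]].
  - exact/coef_at_ideal/ideal_spanP.
  - have [_ sfa Ea] := fP _ at_; exists (f a); split=> //.
    exact/mem_ideal_span/map_f.
  have Iq : I q by apply: ideal_span_sub Sq => // r /mapP[a /fP[? _ _] ->].
  rewrite -(subrK q p); case: (ideal_spanP (map f t ++ s)) => _ + _; apply.
    apply/ls/sN; first exact: idealB.
    exact: poly_size_pred.
  exact: lt.
have idL : ideal (\bigcup_(J in [set coef_at I n | n in setT]) J).
  apply: ideal_bigcup_chain.
  - by exists (coef_at I 0), 0%N.
  - by move=> _ [n _ <-]; exact: coef_at_ideal.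
  - move=> _ _ [m _ <-] [n _ <-].
    by have [mn|/ltnW nm] := leqP m n; [left|right]; exact: coef_at_le.
have [t Et] := noeth _ idL.
have [|f fP] := @choice_in _ (nat * {poly A})%type t
    (fun a np => [/\ I np.2, (size np.2 <= np.1.+1)%N & np.2`_np.1 = a]) (0%N, 0).
  move=> a /mem_ideal_span; rewrite -Et => -[_ [n _ <-] [p [Ip sp Ep]]].
  by exists (n, p).
pose M := \max_(a <- t) (f a).1.
have [s sI sM] := low M.
pose F := [seq (f a).2 | a <- t].
exists (F ++ s); apply/seteqP; split; last first.
  by apply: ideal_span_sub => // p; rewrite mem_cat => /orP[/mapP[a /fP[? _ _] ->]|/sI].
have [lF ls] := span_cat F s.
move=> p; move: {2}(size p) (leqnn (size p)) => n; elim: n p => [|n IHn] p sp Ip.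
  by apply/ls/sM => //; exact: leq_trans sp _.
have [Mn|nM] := leqP M n; last by apply/ls/sM => //; exact: leq_trans sp _.
have : (\bigcup_(J in [set coef_at I n | n in setT]) J) p`_n.
  by exists (coef_at I n); [exists n|exists p].
rewrite Et => /(@ideal_span_sub _ t (coef_at (ideal_span F) n)).
case=> [|a at_|q [Sq sq Eq]].
- exact/coef_at_ideal/ideal_spanP.
- have [_ sfa Ea] := fP _ at_.
  apply: (@coef_at_le _ (f a).1 n); first exact: ideal_spanP.
    by apply: leq_trans Mn; exact: leq_bigmax_seq.
  exists (f a).2; split=> //; exact/mem_ideal_span/map_f.
have Iq : I q by apply: ideal_span_sub Sq => // r /mapP[a /fP[? _ _] ->].
rewrite -(subrK q p); case: (ideal_spanP (F ++ s)) => _ + _; apply.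
  apply: IHn; [exact: poly_size_pred|exact: idealB].
exact: lF.
Qed.

End HilbertBasis.

Definition divides (R : comPzRingType) (a b : R) : Prop := exists q, b = q * a.

Section Divides.
Variable R : comPzRingType.
Implicit Types a b c : R.

Lemma divides0 a : divides a 0. Proof. by exists 0; rewrite mul0r. Qed.

Lemma dividesD a b c : divides a b -> divides a c -> divides a (b + c).
Proof. by move=> [q ->] [r ->]; exists (q + r); rewrite mulrDl. Qed.

Lemma dividesMl a b c : divides a c -> divides a (b * c).
Proof. by move=> [q ->]; exists (b * q); rewrite mulrA. Qed.

Lemma dividesB a b c : divides a b -> divides a c -> divides a (b - c).
Proof. by move=> ab ac; apply: dividesD => //; rewrite -mulN1r; exact: dividesMl. Qed.

Lemma dividesMr a b c : divides a b -> divides a (b * c).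
Proof. by rewrite mulrC; exact: dividesMl. Qed.

Lemma dividesM a b c d : divides a b -> divides c d -> divides (a * c) (b * d).
Proof. by move=> [q ->] [r ->]; exists (q * r); ring. Qed.

Lemma divides_refl a : divides a a. Proof. by exists 1; rewrite mul1r. Qed.

End Divides.

(* Complete integral closure, without fractions: if all x (w / c)^n are in A,  *)
(* then so is w / c.                                                           *)
Definition completely_integrally_closed (A : idomainType) : Prop :=
  forall c x w : A, c != 0 -> x != 0 ->
    (forall n, divides (c ^+ n) (x * w ^+ n)) -> divides c w.

(** The elements of A of the form x p(w / c), p a polynomial, form the ideal [J None]. It is
    finitely generated, so polynomials of size at most some N suffice. It contains x (w / c)^N, so w
    / c is a root of X^N - p with p of size at most N, hence integral. *)
Lemma noetherian_normal_cic (A : idomainType) :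
  noetherian A -> normal_domain A -> completely_integrally_closed A.
Proof.
move=> noeth normal c x w c0 x0 cxw.
pose F := {fraction A}; pose e : {rmorphism A -> F} := @tofrac A.
pose z : F := e w / e c.
have ec0 : e c != 0 by rewrite tofrac_eq0.
have ex0 : e x != 0 by rewrite tofrac_eq0.
pose J N := [set a | exists p : {poly A},
  (if N is Some n then (size p <= n)%N else true) /\ e a = e x * (map_poly e p).[z]].
have idJ N : ideal (J N).
  split=> [|a b [p [sp Ea]] [q [sq Eb]]|a b [p [sp Eb]]].
  - exists 0; split; first by case: N => // n; rewrite size_poly0.
    by rewrite !rmorph0 horner0 mulr0.
  - exists (p + q); split; last by rewrite rmorphD Ea Eb -mulrDr -hornerD -rmorphD.
    case: N sp sq => // n sp sq.
    by apply: (leq_trans (size_polyD _ _)); rewrite geq_max sp.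
  - exists (a *: p); split.
      by case: N sp => // n; apply: leq_trans; exact: size_scale_leq.
    by rewrite rmorphM Eb map_polyZ hornerZ mulrCA.
have [s Es] := noeth _ (idJ None).
have [N sN] : exists N, forall a, a \in s -> J (Some N) a.
  have : forall a, a \in s -> J None a by move=> a; rewrite Es; exact: mem_ideal_span.
  elim: (s) => [|a t IHt] tJ; first by exists 0%N.
  have [n tn] := IHt (fun b bt => tJ b (mem_behead (s := a :: t) bt)).
  have [p [_ Ea]] := tJ a (mem_head _ _).
  exists (maxn n (size p)) => b; rewrite inE => /orP[/eqP ->|/tn[q [sq Eb]]].
    by exists p; split=> //; rewrite leq_maxr.
  by exists q; split=> //; apply: leq_trans sq _; rewrite leq_maxl.
have [q Eq] := cxw N.
have Eqz : e q = e x * z ^+ N.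
  apply: (mulIf (expf_neq0 N ec0)).
  rewrite -mulrA -exprMn divfK // -!rmorphXn -!rmorphM /=; congr (e _).
  by rewrite Eq.
have : J None q by exists 'X^N; rewrite map_polyXn hornerXn.
rewrite Es => /(ideal_span_sub (idJ (Some N)) sN)[p [sp Ep]].
have zp : z ^+ N = (map_poly e p).[z] by apply: (mulfI ex0); rewrite -Eqz.
have [|a Ea] := normal z.
  exists ('X^N - p).
    by rewrite monicE lead_coefDl ?lead_coefXn // size_polyN size_polyXn ltnS.
  rewrite /root -/(map_poly e _) rmorphB /= map_polyXn hornerD hornerN hornerXn.
  by rewrite zp subrr.
exists a; apply/eqP; rewrite -tofrac_eq rmorphM /= -Ea /z; apply/eqP.
by rewrite divfK.
Qed.

(** * Products of coefficients over a completely integrally closed domain *)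

Section Content.
Variable A : idomainType.
Hypothesis cic : completely_integrally_closed A.
Implicit Types v r : {poly A}.

Lemma coefM_top v r m n : (size v <= m.+1)%N -> (size r <= n.+1)%N ->
  (v * r)`_(m + n) = v`_m * r`_n.
Proof.
move=> sv sr; rewrite coefM (bigD1 (Ordinal (leq_addr n m : m < (m + n).+1)%N)) //=.
rewrite addKn big1 ?addr0 // => i /eqP im.
have {}im : nat_of_ord i != m by apply/eqP => E; apply: im; exact: val_inj.
have [lt|gt|E] := ltngtP i m; last by rewrite E eqxx in im.
  rewrite [r`_ _]nth_default ?mulr0 //; apply: leq_trans sr _.
  by rewrite ltn_subRL ltn_add2r.
by rewrite [v`_ _]nth_default ?mul0r //; exact: leq_trans sv _.
Qed.

(* Dedekind's Prague theorem.                                                  *)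
Lemma divides_content v r d : d != 0 ->
  (forall k, divides d (v * r)`_k) -> forall i j, divides d (v`_i * r`_j).
Proof.
move: {2}(size r) (leqnn (size r)) => n.
elim: n v r d => [|n IHn] v r d.
  rewrite leqn0 size_poly_eq0 => /eqP -> _ _ i j.
  by rewrite coef0 mulr0; exact: divides0.
move=> sr; move: {2}(size v) (leqnn (size v)) => m.
elim: m v => [|m IHm] v.
  rewrite leqn0 size_poly_eq0 => /eqP -> _ _ i j.
  by rewrite coef0 mul0r; exact: divides0.
move=> sv d0 dvr.
have [->|v0] := eqVneq v 0.
  by move=> i j; rewrite coef0 mul0r; exact: divides0.
have top : divides d (v`_m * r`_n) by rewrite -coefM_top.
pose r' := r - r`_n *: 'X^n; pose v' := v - v`_m *: 'X^m.
have sr' : (size r' <= n)%N.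
  apply: poly_size_pred => //; last by rewrite coefZ coefXn eqxx mulr1.
  by apply: (leq_trans (size_scale_leq _ _)); rewrite size_polyXn.
have sv' : (size v' <= m)%N.
  apply: poly_size_pred => //; last by rewrite coefZ coefXn eqxx mulr1.
  by apply: (leq_trans (size_scale_leq _ _)); rewrite size_polyXn.
(* For w = v_m r'_j, complete integral closedness is applied once d^k divides w^k v_i for all k and
   i. To pass from (s, t) to (d s, t w), the induction hypothesis on the size of r is used for t v_m
   v and r': their product t v_m (v r) - (v_m r_n) t v X^n has coefficients divisible by d s. *)
have lead' j : divides d (v`_m * r'`_j).
  set w := v`_m * r'`_j.
  pose good s t := s != 0 /\ forall i, divides s (t * v`_i).
  have step s t : good s t -> good (d * s) (t * w).
    move=> [s0 st]; have ds0 : d * s != 0 by rewrite mulf_neq0.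
    split=> // i.
    have := IHn ((t * v`_m) *: v) r' (d * s) sr' ds0 _ i j.
    rewrite coefZ (_ : t * w * v`_i = t * v`_m * v`_i * r'`_j); last by rewrite /w; ring.
    apply=> k; rewrite -scalerAl coefZ /r' mulrBr coefB -scalerAr coefZ.
    have -> : t * v`_m * ((v * r)`_k - r`_n * (v * 'X^n)`_k)
      = (v * r)`_k * (t * v`_m) - (v`_m * r`_n) * (t * (v * 'X^n)`_k) by ring.
    apply: dividesB; first exact: dividesM.
    apply: dividesM => //; rewrite coefMXn; case: ifP => // _.
    by rewrite mulr0; exact: divides0.
  have goodX k : good (d ^+ k) (w ^+ k).
    elim: k => [|k]; last by rewrite exprS exprSr; exact: step.
    by rewrite !expr0; split=> [|i]; [exact: oner_neq0|exists (v`_i); rewrite mulr1 mul1r].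
  apply: (@cic d (lead_coef v)) => //; first by rewrite lead_coef_eq0.
  by move=> k; rewrite mulrC; have [_] := goodX k; apply.
have lead j : divides d (v`_m * r`_j).
  have -> : r`_j = r'`_j + r`_n * (j == n)%:R by rewrite coefB coefZ coefXn subrK.
  by rewrite mulrDr mulrA; apply: dividesD => //; exact: dividesMr.
move=> i j; have -> : v`_i = v'`_i + v`_m * (i == m)%:R.
  by rewrite coefB coefZ coefXn subrK.
rewrite mulrDl; apply: dividesD; last by rewrite mulrAC; exact: dividesMr.
apply: IHm => // k; rewrite /v' mulrBl coefB -scalerAl coefZ.
apply: dividesB => //; rewrite coefXnM; case: ifP => // _.
by rewrite mulr0; exact: divides0.
Qed.

End Content.

(** * Hypersurfaces *)

Section SpecTopology.
Variable R : comPzRingType.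
Implicit Types (E : set R) (Z : set (spec R)) (p q : spec R).

Lemma spec_inj p q : prime_set p = prime_set q -> p = q.
Proof.
case: p q => P pP [Q pQ] /= E; case: Q / E pQ => pQ.
by congr Spec; exact: Prop_irrelevance.
Qed.

Lemma closedE Z : closed Z <-> exists E, Z = zeros E.
Proof.
rewrite -openC; split=> -[E EZ]; exists E; first by rewrite -[LHS]setCK EZ setCK.
by rewrite EZ.
Qed.

Lemma closed_zeros E : closed (zeros E).
Proof. by apply/closedE; exists E. Qed.

Definition vanishing Z : set R := [set a | forall p, Z p -> prime_set p a].

Lemma vanishing_ideal Z : ideal (vanishing Z).
Proof.
split=> [p _|x y Zx Zy p Zp|a x Zx p Zp]; case: (prime_setP p) => -[p0 pD pM] _ _ //.
  by apply: pD; [exact: Zx|exact: Zy].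
by apply: pM; exact: Zx.
Qed.

Lemma zeros_vanishing Z : closed Z -> zeros (vanishing Z) = Z.
Proof.
move=> /closedE[E ->]; apply/seteqP; split=> p /= sub x; last by apply.
by move=> Ex; apply: sub => q; apply.
Qed.

Lemma irreducible_zeros q : irreducible (zeros (prime_set q)).
Proof.
split=> [|F G /closedE[E ->] /closedE[E' ->] sub]; first by exists q => x.
by have [|sq|sq] := sub q; [move=> x|left|right] => // p qp x /sq /qp.
Qed.

Lemma irreducible_vanishing Z : irreducible Z -> prime_ideal (vanishing Z).
Proof.
case=> -[p Zp] irr; split; first exact: vanishing_ideal.
  by case: (prime_setP p) => _ p1 _ /(_ _ Zp).
move=> x y Zxy.
have [||q Zq|sub|sub] := irr (zeros [set x]) (zeros [set y]).
- exact: closed_zeros.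
- exact: closed_zeros.
- by case: (prime_setP q) => _ _ /(_ _ _ (Zxy _ Zq))[]; [left|right] => _ ->.
- by left=> q /sub; apply.
- by right=> q /sub; apply.
Qed.

End SpecTopology.

Section Hypersurfaces.
Variable R : idomainType.
Implicit Types (p q : spec R) (H : set (spec R)).

Lemma zero_prime_subproof : prime_ideal [set (0 : R)].
Proof.
split; first by split=> [//|x y -> ->|a x ->]; rewrite ?addr0 ?mulr0.
  by move=> /eqP; rewrite oner_eq0.
by move=> x y /eqP; rewrite mulf_eq0 => /orP[] /eqP; [left|right].
Qed.
Definition generic_point : spec R := Spec zero_prime_subproof.

Lemma zeros_generic : zeros (prime_set generic_point) = setT.
Proof. by apply/seteqP; split=> // p _ x ->; case: (prime_setP p) => -[]. Qed.

Definition height_one q : Prop :=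
  (exists2 x, prime_set q x & x != 0) /\
  forall q' x, prime_set q' `<=` prime_set q -> prime_set q' x -> x != 0 ->
    prime_set q' = prime_set q.

(** For q minimal over the ideal of H inside p, V(q) is a component of H. A chain of length 1 above
    V(q) makes q nonzero; a nonzero prime q' strictly inside q would give the chain V(q) < V(q') <
    Spec R of length 2. *)
Lemma hypersurface_component H p : hypersurface H -> H p ->
  exists q, [/\ prime_set q `<=` prime_set p, vanishing H `<=` prime_set q
    & height_one q].
Proof.
move=> [clH compH] Hp.
have [q [Hq qp qmin]] := @minimal_prime _ (vanishing H) p (fun x Hx => Hx p Hp).
exists q; split=> //.
have [|[C [C0 Cirr Clt]] no2] := compH (zeros (prime_set q)).
  split; first exact: irreducible_zeros.
    by move=> r qr; rewrite -(zeros_vanishing clH) => x /Hq /qr.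
  move=> Z' irrZ' Z'H qZ'.
  pose Q := Spec (irreducible_vanishing irrZ').
  have EQ : vanishing Z' = prime_set q.
    apply: (qmin Q) => /= x; first by move=> Hx r /Z'H; exact: Hx.
    by move=> Z'x; apply/Z'x/qZ'.
  apply/seteqP; split=> // r Z'r x; rewrite -EQ; exact.
split.
  apply: contrapT => no; case: (Clt 0%N isT) => _; apply; rewrite C0.
  suff -> : zeros (prime_set q) = setT by [].
  rewrite -zeros_generic; congr zeros; apply/seteqP; split=> x; last first.
    by move=> ->; case: (prime_setP q) => -[].
  by move=> qx; apply/eqP/negPn/negP => x0; apply: no; exists x.
move=> q' x q'q q'x x0; apply: contrapT => ne; apply: no2.
exists (fun i => if i is i'.+1 then if i' is _.+1 then setT else zeros (prime_set q')
                 else zeros (prime_set q)); split=> //.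
- move=> [|[|i]] _; split; try exact: closed_zeros; try exact: irreducible_zeros.
    by rewrite -zeros_generic; exact: closed_zeros.
  by rewrite -zeros_generic; exact: irreducible_zeros.
- move=> [|[|//]] _; split=> //.
  + by move=> r qr y /q'q /qr.
  + by move=> /(_ q' (fun y q'y => q'y)) qq'; apply: ne; apply/seteqP.
  + move=> /(_ generic_point I x q'x) /= x00; by rewrite x00 eqxx in x0.
Qed.

(** A component is V(P) with P minimal over [E], and V(P) < Spec R is a chain of length 1 because of
    [x0]. In a chain of length 2 the middle term has its ideal inside P. By height one that ideal is
    P or 0, and one of the two inclusions is not strict. *)
Lemma zeros_hypersurface (E : set R) x0 : E x0 -> x0 != 0 ->
  (forall q, E `<=` prime_set q ->
     (forall q', E `<=` prime_set q' -> prime_set q' `<=` prime_set q ->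
        prime_set q' = prime_set q) -> height_one q) ->
  hypersurface (zeros E).
Proof.
move=> Ex0 x00 ht; split; first exact: closed_zeros.
move=> Z [irrZ ZE Zmax].
pose P := Spec (irreducible_vanishing irrZ).
have EP : E `<=` prime_set P by move=> x Ex p /ZE; apply.
have PZ : zeros (prime_set P) = Z.
  apply: Zmax; first exact: irreducible_zeros.
    by move=> q Pq x /EP /Pq.
  by move=> q Zq x; apply.
have [_ Pht] : height_one P.
  apply: ht => // q Eq qP; apply/seteqP; split=> // x Px.
  have EZ : zeros (prime_set q) = Z.
    apply: Zmax; first exact: irreducible_zeros.
      by move=> r qr y /Eq /qr.
    by move=> r Zr y /qP; apply.
  by apply: Px; rewrite -EZ => y.
split.
  exists (fun i => if i is 0%N then Z else setT); split=> //.
  - move=> [|i] _; [rewrite -PZ|rewrite -zeros_generic]; split;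
      [exact: closed_zeros|exact: irreducible_zeros| |]; 
      [exact: closed_zeros|exact: irreducible_zeros].
  - move=> [|//] _; split=> // /(_ generic_point I) /ZE /(_ _ Ex0) /= E0.
    by rewrite E0 eqxx in x00.
move=> [C [C0 Cirr Clt]].
have [cl1 irr1] := Cirr 1%N isT.
have [Z1 nZ1] := Clt 0%N isT; have [_ n12] := Clt 1%N isT.
pose P1 := Spec (irreducible_vanishing irr1).
have [[x [P1x x_0]]|no] := pselect (exists x, prime_set P1 x /\ x != 0).
  have EP1 : vanishing (C 1%N) = prime_set P.
    by apply: (Pht P1 x) => // y P1y r Zr; apply/P1y/Z1; rewrite C0.
  by apply: nZ1; rewrite C0 -(zeros_vanishing cl1) EP1 PZ.
apply: n12; rewrite -(zeros_vanishing cl1) => r _ y P1y.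
have -> : y = 0 by apply/eqP/negPn/negP => y0; apply: no; exists y.
by case: (prime_setP r) => -[].
Qed.

(* If P is minimal over the ideal below then P w lies in cR for some w not in  *)
(* cR. By complete integral closedness P w is not in cP, so that a w = c u     *)
(* with a in P and u outside P; then w Q lies in cQ for every prime Q < P,    *)
(* which forces Q = 0.                                                         *)
Lemma colon_hypersurface (Z : set R) (c : R) :
  noetherian R -> completely_integrally_closed R -> c != 0 ->
  hypersurface (zeros [set b | forall z, Z z -> divides c (b * z)]).
Proof.
move=> noeth cic c0; set I := [set b | _].
have idI : ideal I.
  split=> [z _|x y Ix Iy z Zz|a x Ix z Zz].
  - by rewrite mul0r; exact: divides0.
  - by rewrite mulrDl; apply: dividesD; [exact: Ix|exact: Iy].
  - by rewrite -mulrA; apply: dividesMl; exact: Ix.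
have Ic : I c by move=> z _; apply: dividesMr; exact: divides_refl.
apply: (zeros_hypersurface Ic c0) => P IP Pmin.
have [[P0 PD PM] P1 Pprime] := prime_setP P.
split; first by exists c => //; exact: IP.
have [y Py] := minimal_prime_colon noeth idI IP Pmin.
have [z [Zz ncw]] : exists z, Z z /\ ~ divides c (y * z).
  apply: contrapT => no; apply: P1; apply/Py => z Zz; rewrite mul1r.
  by apply: contrapT => ncw; apply: no; exists z.
set w := y * z in ncw.
have Pw t : prime_set P t -> divides c (t * w).
  by move=> /Py /(_ _ Zz); rewrite mulrA.
(* If w / c maps [Q] into itself, every x (w / c)^n stays in R, and complete integral closedness
   puts w / c in R, against [ncw]. *)
have stable (Q : set R) x : Q x -> x != 0 ->
    (forall t, Q t -> exists2 u, Q u & t * w = u * c) -> False.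
  move=> Qx x0 Qw; apply: ncw; apply: (cic c x w c0 x0) => n.
  have [u _ ->] : exists2 u, Q u & x * w ^+ n = u * c ^+ n.
    elim: n => [|n [u Qu E]]; first by exists x; rewrite // !expr0.
    have [v Qv E'] := Qw _ Qu; exists v => //.
    by rewrite exprSr mulrA E mulrAC E' exprS; ring.
  by exists u.
have [a [u [Pa nPu E]]] : exists a u, [/\ prime_set P a, ~ prime_set P u & a * w = u * c].
  apply: contrapT => no; apply: (stable (prime_set P) c) => //; first exact: IP.
  move=> t Pt; have [u Eu] := Pw t Pt; exists u => //.
  by apply: contrapT => nPu; apply: no; exists t, u.
move=> Q x QP Qx x0; apply/seteqP; split=> // t Pt.
have [[Q0 QD QM] Q1 Qprime] := prime_setP Q.
(* If a lies in Q and t w = s c with t in P, then t u = s a lies in Q while u does not, so t lies in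
   Q. If a lies outside Q and r w = s c with r in Q, then s a = u r puts s in Q, so w / c maps Q
   into itself. *)
have [Qa|nQa] := pselect (prime_set Q a).
  have [s Es] := Pw t Pt.
  have : prime_set Q (t * u).
    have -> : t * u = s * a; last exact: QM.
    apply: (mulIf c0); rewrite -mulrA -E.
    by rewrite mulrCA Es; ring.
  by move=> /Qprime[//|/QP].
exfalso; apply: (stable (prime_set Q) x) => // r Qr.
have [s Es] := Pw r (QP _ Qr); exists s => //.
have : prime_set Q (s * a).
  have -> : s * a = u * r; last exact: QM.
  by apply: (mulIf c0); rewrite mulrAC -Es -mulrA [w * a]mulrC E; ring.
by move=> /Qprime[].
Qed.

End Hypersurfaces.

(** * Sections as elements of a field *)

Section Fractions.
Variables (R : comPzRingType) (p : spec R).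

Lemma mkfracD (a b : R) (s t : denom p) :
  mkfrac a s + mkfrac b t = mkfrac (a * sval t + b * sval s) (denomM s t).
Proof. exact: stalk_addE. Qed.

Lemma mkfracM (a b : R) (s t : denom p) :
  mkfrac a s * mkfrac b t = mkfrac (a * b) (denomM s t).
Proof. exact: stalk_mulE. Qed.

Lemma mkfrac_eq (a b : R) (s t : denom p) :
  a * sval t = b * sval s -> mkfrac a s = mkfrac b t.
Proof. by move=> E; apply/frac_eqP; exists (denom1 p); rewrite E. Qed.

Lemma denomP (s : denom p) : ~ prime_set p (sval s).
Proof. exact/asboolP/(proj2_sig s). Qed.

End Fractions.

Section Constants.
Variables (R : comPzRingType) (U : set (spec R)).

Lemma sections_cst0 : sections_cst U 0 = 0.
Proof. by []. Qed.

Lemma sections_cst1 : sections_cst U 1 = 1.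
Proof. by []. Qed.

Lemma sections_cstD a b :
  sections_cst U (a + b) = sections_cst U a + sections_cst U b.
Proof.
apply: sections_eq => p Up.
apply: (etrans _ (esym (mkfracD a b (denom1 p) (denom1 p)))).
by apply: mkfrac_eq; rewrite /=; ring.
Qed.

Lemma sections_cstM a b :
  sections_cst U (a * b) = sections_cst U a * sections_cst U b.
Proof.
apply: sections_eq => p Up.
apply: (etrans _ (esym (mkfracM a b (denom1 p) (denom1 p)))).
by apply: mkfrac_eq; rewrite /=; ring.
Qed.

End Constants.

Section Values.
Variables (R : comPzRingType) (F : fieldType) (e : {rmorphism R -> F}).
Hypothesis einj : injective e.

Lemma nonzero_notin_prime (p : spec R) s : ~ prime_set p s -> e s != 0.
Proof.
case: (prime_setP p) => -[p0 _ _] _ _ ps; apply/eqP => es.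
by apply: ps; suff -> : s = 0 by []; apply: einj; rewrite es rmorph0.
Qed.

Section AtPoint.
Variable p : spec R.

Definition value (x : stalk p) : F := e (repr x).1 / e (sval (repr x).2).

Lemma denom_neq0 (s : denom p) : e (sval s) != 0.
Proof. exact/nonzero_notin_prime/denomP. Qed.

Lemma value_mkfrac a (s : denom p) : value (mkfrac a s) = e a / e (sval s).
Proof.
have [u E] := frac_repr a s; rewrite /value.
apply/eqP; rewrite eqr_div ?denom_neq0 //; apply/eqP.
apply: (mulfI (denom_neq0 u)); rewrite -!rmorphM; congr (e _).
exact: E.
Qed.

Lemma value_inj : injective value.
Proof.
move=> x y; have [a [s ->]] := fracP x; have [b [t ->]] := fracP y.
rewrite !value_mkfrac => /eqP; rewrite eqr_div ?denom_neq0 // -!rmorphM.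
by move=> /eqP /einj; exact: mkfrac_eq.
Qed.

Lemma value_eq_mkfrac (x : stalk p) a (s : R) (ps : `[< ~ prime_set p s >]) :
  value x = e a / e s -> x = mkfrac a (exist _ s ps : denom p).
Proof. by move=> E; apply: value_inj; rewrite value_mkfrac. Qed.

Lemma valueD : {morph value : x y / x + y}.
Proof.
move=> x y; have [a [s ->]] := fracP x; have [b [t ->]] := fracP y.
rewrite mkfracD !value_mkfrac /= rmorphD !rmorphM.
by field; rewrite !denom_neq0.
Qed.

Lemma valueM : {morph value : x y / x * y}.
Proof.
move=> x y; have [a [s ->]] := fracP x; have [b [t ->]] := fracP y.
rewrite mkfracM !value_mkfrac /= !rmorphM.
by field; rewrite !denom_neq0.
Qed.

Lemma value_cst a : value (mkfrac a (denom1 p)) = e a.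
Proof. by rewrite value_mkfrac /= rmorph1 divr1. Qed.

Lemma value1 : value 1 = 1.
Proof. by rewrite [LHS]value_cst rmorph1. Qed.

Lemma valueN : {morph value : x / - x}.
Proof.
move=> x; apply/eqP; rewrite -addr_eq0 -valueD addNr.
by rewrite [value 0]value_cst rmorph0.
Qed.

End AtPoint.

(** O(U) is taken inside any field [F] containing [R]. With [F] containing A[T], functions over Spec
    A and over Spec A[T] can be multiplied in one field. *)
Definition regular (U : set (spec R)) : {pred F} := fun x =>
  `[< forall p, U p -> exists s a, ~ prime_set p s /\ e s * x = e a >].

Lemma regularP U x : reflect
  (forall p, U p -> exists s a, ~ prime_set p s /\ e s * x = e a) (x \in regular U).
Proof. exact: asboolP. Qed.

Lemma regular_subring U : subring_closed (regular U).
Proof.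
split.
- apply/regularP => p _; exists 1, 1; split; last by rewrite mulr1.
  by case: (prime_setP p).
- move=> x y /regularP xU /regularP yU; apply/regularP => p Up.
  have [s [a [ps Ea]]] := xU p Up; have [t [b [pt Eb]]] := yU p Up.
  have [_ _ pM] := prime_setP p.
  exists (s * t), (t * a - s * b); split; first by move=> /pM[].
  by rewrite rmorphB !rmorphM -Ea -Eb; ring.
- move=> x y /regularP xU /regularP yU; apply/regularP => p Up.
  have [s [a [ps Ea]]] := xU p Up; have [t [b [pt Eb]]] := yU p Up.
  have [_ _ pM] := prime_setP p.
  exists (s * t), (a * b); split; first by move=> /pM[].
  by rewrite !rmorphM -Ea -Eb; ring.
Qed.
HB.instance Definition _ U :=
  GRing.isSubringClosed.Build F (regular U) (regular_subring U).

Record coord_ring (U : set (spec R)) :=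
  CoordRing { coord_val : F; coord_valP : coord_val \in regular U }.

HB.instance Definition _ U := [isSub for @coord_val U].
HB.instance Definition _ U := [Choice of coord_ring U by <:].
HB.instance Definition _ U := [SubChoice_isSubComNzRing of coord_ring U by <:].

Section CoordRing.
Variable U : set (spec R).

Lemma coord_cst_subproof a : e a \in regular U.
Proof.
apply/regularP => p _; exists 1, a; split; last by rewrite rmorph1 mul1r.
by case: (prime_setP p).
Qed.
Definition coord_cst a : coord_ring U := CoordRing (coord_cst_subproof a).

Lemma coord_valD (x y : coord_ring U) : \val (x + y) = \val x + \val y.
Proof. exact: rmorphD. Qed.

Lemma coord_valM (x y : coord_ring U) : \val (x * y) = \val x * \val y.
Proof. exact: rmorphM. Qed.

Lemma coord_valX (x : coord_ring U) n : \val (x ^+ n) = \val x ^+ n.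
Proof. exact: rmorphXn. Qed.

Lemma coord_cst_zmod : zmod_morphism coord_cst.
Proof. by move=> a b; apply: val_inj; rewrite /= rmorphB. Qed.
Lemma coord_cst_monoid : monoid_morphism coord_cst.
Proof. by split=> [|a b]; apply: val_inj; rewrite /= ?rmorph1 ?rmorphM. Qed.
HB.instance Definition _ :=
  GRing.isZmodMorphism.Build R (coord_ring U) coord_cst coord_cst_zmod.
HB.instance Definition _ :=
  GRing.isMonoidMorphism.Build R (coord_ring U) coord_cst coord_cst_monoid.

End CoordRing.
End Values.

(** * An affine D(I) makes I O(D(I)) the unit ideal *)

Section AffineUnit.
Variables (R : idomainType) (F : fieldType) (e : {rmorphism R -> F}).
Hypothesis einj : injective e.

Lemma open_generic (U : set (spec R)) p : open U -> U p -> U (generic_point R).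
Proof.
move=> [E ->] /= pE gE; apply: pE => x /gE /= ->.
by case: (prime_setP p) => -[].
Qed.

(** A nonempty open set contains the generic point, where the fraction representing [f] near [p]
    still represents it. *)
Lemma value_constant (U : set (spec R)) (f : sections U) : open U ->
  exists x, forall p (Up : U p), value e (germ f Up) = x.
Proof.
move=> oU; have [Ug|nUg] := pselect (U (generic_point R)); last first.
  by exists 0 => p Up; case: nUg; exact: open_generic Up.
exists (value e (germ f Ug)) => p Up.
have [V [oV Vp [a [s fV]]]] := germP f Up.
have [sp ->] := fV p Up Vp.
have [sg ->] := fV _ Ug (open_generic oV Vp).
by rewrite !value_mkfrac.
Qed.

Lemma restrict_inj (U V : set (spec R)) (VU : V `<=` U) p : open U -> open V -> V p ->
  injective (restrict VU).
Proof.
move=> oU oV Vp f g E; apply: sections_eq => q Uq; apply: (value_inj einj).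
have [x fx] := value_constant f oU; have [y gy] := value_constant g oU.
rewrite fx gy -(fx p (VU p Vp)) -(gy p (VU p Vp)).
by rewrite -[germ f _]/(germ (restrict VU f) Vp) E.
Qed.

Section Affine.
Variables (I : set R) (x0 : R).
Hypotheses (Ix0 : I x0) (x0_neq0 : x0 != 0).
Let U := ~` zeros I.

Let coord_cst := @coord_cst R F e U.

(** The elements of B that correspond to elements of I O(U) form an ideal. If it lay in a prime p,
    some a in I outside f(p) would be invertible near f(p), and its image b in B would be a unit at
    p. But b belongs to that ideal, hence to p. *)
Lemma affine_complement_unit :
  affine_open U -> ideal_gen (coord_cst @` I) 1.
Proof.
move=> [oU [B [f [phi [[finj fU fcont fopen] phiP phiR]]]]].
have Uf q : U (f q) by rewrite -fU; exists q.
have Ug : U (generic_point R).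
  by move=> /(_ _ Ix0) /= E; move: x0_neq0; rewrite E eqxx.
have [phiB phiM [psi phiK psiK]] := phiP U oU (@subset_refl _ U).
(* Sections over f^-1 U = Spec B that agree on a nonempty open set are equal. *)
have rigid (s s' : sections (f @^-1` U)) (W : set (spec B)) w : open W -> W w ->
    (forall q (Uq : (f @^-1` U) q), W q -> germ s Uq = germ s' Uq) -> s = s'.
  move=> oW Ww ss'.
  have VU : f @` W `<=` U by move=> _ [q _ <-].
  have oV := fopen W oW.
  have [_ _ phiVbij] := phiP _ oV VU.
  rewrite -(psiK s) -(psiK s'); congr (phi U _).
  apply: (restrict_inj (VU := VU) (p := f w) oU oV); first by exists w.
  apply: (bij_inj phiVbij).
  rewrite !(phiR _ _ VU oU oV (@subset_refl _ U)) !psiK.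
  apply: sections_eq => q Vq; apply: ss'.
  by case: Vq => q' Wq' /finj <-.
(* The denominators of s form an ideal [T]. If [T] lay in a prime p, a local expression a / t of s
   at p would give t s = a everywhere by [rigid], so t would lie in [T] but outside p. *)
have surj (s : sections (f @^-1` U)) : exists b, s = sections_cst _ b.
  pose T := [set t : B | exists b, sections_cst _ t * s = sections_cst _ b].
  have idT : ideal T.
    split=> [|x y [a Ea] [b Eb]|c x [a Ea]].
    - by exists 0; rewrite sections_cst0 mul0r.
    - by exists (a + b); rewrite !sections_cstD mulrDl Ea Eb.
    - by exists (c * a); rewrite !sections_cstM -mulrA Ea.
  have [[b]|T1] := pselect (T 1).
    by rewrite sections_cst1 mul1r => ->; exists b.
  have [p Tp] := prime_over idT T1.
  have [W [oW Wp [a [t sW]]]] := germP s (Uf p).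
  have [tp _] := sW p (Uf p) Wp.
  have Tt : T t.
    exists a; apply: (rigid _ _ W p oW Wp) => q Uq Wq.
    have [tq E] := sW q Uq Wq.
    rewrite /= E mkfracM; apply: mkfrac_eq; rewrite /=; ring.
  by move/asboolP: tp; case; exact: Tp.
pose is_val (g : sections U) (x : coord_ring e U) :=
  forall p (Up : U p), value e (germ g Up) = \val x.
have ex_val g : exists x, is_val g x.
  have [x gx] := value_constant g oU.
  have xP : x \in regular e U.
    apply/regularP => p Up; have [a [s E]] := fracP (germ g Up).
    exists (sval s), a; split; first exact: denomP.
    by rewrite -(gx p Up) E (value_mkfrac einj) mulrC divfK // denom_neq0.
  by exists (CoordRing xP) => p Up; rewrite (gx p Up).
pose T := [set b : B | exists g x,
  [/\ sections_cst _ b = phi U g, is_val g x & ideal_gen (coord_cst @` I) x]].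
have [J0 JD JM] := ideal_genP (coord_cst @` I).
have phi0 : phi U 0 = 0 by rewrite -(subrr (0 : sections U)) phiB subrr.
have phiD g h : phi U (g + h) = phi U g + phi U h.
  have phiN k : phi U (- k) = - phi U k by rewrite -[- k]add0r phiB phi0 add0r.
  by rewrite -[h in LHS]opprK phiB phiN opprK.
have idT : ideal T.
  split=> [|a b [g [x [Ea gx Jx]]] [h [y [Eb hy Jy]]]|c a [g [x [Ea gx Jx]]]].
  - exists 0, 0; split=> //.
    by move=> p Up; rewrite [LHS](value_cst einj) !rmorph0.
  - exists (g + h), (x + y); split; last exact: JD.
      by rewrite sections_cstD phiD Ea Eb.
    by move=> p Up; rewrite /= valueD // gx hy.
  - have [z hz] := ex_val (psi (sections_cst _ c)).
    exists (psi (sections_cst _ c) * g), (z * x); split; last exact: JM.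
      by rewrite sections_cstM phiM.2 psiK Ea.
    by move=> p Up; rewrite /= valueM // gx hz.
have [[g [x [E1 gx Jx]]]|T1] := pselect (T 1).
  suff <- : x = 1 by [].
  have g1 : g = 1 by apply: (can_inj phiK); rewrite -E1 phiM.1.
  by apply: val_inj; rewrite /= -(gx _ Ug) g1 value1.
have [p Tp] := prime_over idT T1.
have [a [Ia pa]] : exists a, I a /\ ~ prime_set (f p) a.
  apply: contrapT => no; apply: (Uf p) => a Ia; apply: contrapT => pa.
  by apply: no; exists a.
pose V : set (spec R) := ~` zeros [set a].
have VU : V `<=` U by move=> q aq Iq; apply: aq => _ ->; exact: Iq.
have oV : open V by exists [set a].
have Vp : V (f p) by move=> /(_ a erefl).
have aV q : V q -> `[< ~ prime_set q a >].
  by move=> Vq; apply/asboolP => qa; apply: Vq => _ ->.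
have invP : @locally_fraction R V (fun q Vq => mkfrac 1 (exist _ a (aV q Vq) : denom q)).
  move=> q Vq; exists V; split=> //; exists 1, a => r Vr _.
  by exists (aV r Vr).
pose inv := Sections invP.
have [b Eb] := surj (phi U (sections_cst U a)).
have Tb : T b.
  exists (sections_cst U a), (coord_cst a); split=> //.
    by move=> q Uq; rewrite (value_cst einj).
  by apply: sub_ideal_gen; exists a.
have [_ [phiV1 phiVM] _] := phiP V oV VU.
have E : restrict (preimage_subset VU) (sections_cst _ b) * phi V inv = 1.
  rewrite -Eb -(phiR _ _ VU oU oV (@subset_refl _ U)) -phiVM -phiV1; congr (phi V _).
  apply: sections_eq => q Vq; rewrite /= mkfracM; apply: mkfrac_eq; rewrite /=; ring.
have := congr1 (fun s => germ s (Vp : (f @^-1` V) p)) E => /=.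
have [c [t ->]] := fracP (germ (phi V inv) (Vp : (f @^-1` V) p)).
rewrite mkfracM => /frac_eqP[u] /= Eu.
have [[_ _ pM] _ pP] := prime_setP p.
have : prime_set p (sval u * (1 * (1 * sval t))).
  rewrite -Eu (_ : _ * _ = sval u * c * b); last by ring.
  by apply: pM; exact: Tp.
by rewrite !mul1r => /pP[] /denomP.
Qed.

End Affine.
End AffineUnit.

(** * If I O(D(I)) is the unit ideal, D(I) is the spectrum of O(D(I)) *)

Section UnitAffine.
Variables (R : comPzRingType) (F : fieldType) (e : {rmorphism R -> F}).
Hypothesis einj : injective e.
Variable I : set R.
Let U := ~` zeros I.
Let B : comPzRingType := coord_ring e U.
Let iota : {rmorphism R -> B} := @coord_cst R F e U.
Let v : {rmorphism B -> F} := \val.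
Hypothesis IB1 : ideal_gen (iota @` I) 1.

Let vinj : injective v. Proof. exact: val_inj. Qed.
Let v_iota a : v (iota a) = e a. Proof. by []. Qed.

Lemma contract_subproof (q : spec B) : prime_ideal [set a | prime_set q (iota a)].
Proof.
have [[q0 qD qM] q1 qP] := prime_setP q; split.
- split=> [|x y|a x] /=; rewrite ?rmorph0 ?rmorphD ?rmorphM //; first exact: qD.
  exact: qM.
- by rewrite /= rmorph1.
- by move=> x y /=; rewrite rmorphM; exact: qP.
Qed.
Definition contract (q : spec B) : spec R := Spec (contract_subproof q).

Lemma contract_in q : U (contract q).
Proof.
move=> Iq; case: (prime_setP q) => idq + _; apply.
by apply: IB1 => // _ [a Ia <-]; exact: Iq.
Qed.

(** Since the contraction of q is in U, [x] is a fraction there. Membership in q is thus decided by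
    elements of R, which makes [contract] injective and open. *)
Lemma local_fraction (q : spec B) (x : B) : exists s a,
  [/\ ~ prime_set q (iota s), iota s * x = iota a & prime_set q x <-> prime_set q (iota a)].
Proof.
have /regularP /(_ _ (@contract_in q)) [s [a [qs E]]] := valP x.
have E' : iota s * x = iota a by apply: vinj; rewrite rmorphM.
exists s, a; split=> //; rewrite -E'; have [[_ _ qM] _ qP] := prime_setP q.
by split=> [|/qP[]//]; exact: qM.
Qed.

Lemma contract_inj : injective contract.
Proof.
move=> q r E; apply: spec_inj.
have {}E a : prime_set q (iota a) <-> prime_set r (iota a).
  by have := congr1 (fun p => prime_set p a) E => /= ->.
apply/seteqP; split=> x.
  have [s [a [qs Es qx]]] := local_fraction q x => /qx/E; rewrite -Es.
  by have [_ _ rP] := prime_setP r => /rP[/E|].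
have [s [a [rs Es rx]]] := local_fraction r x => /rx/E; rewrite -Es.
by have [_ _ qP] := prime_setP q => /qP[/E|].
Qed.

(** This is the trace on B of the maximal ideal of the local ring of R at p, a ring that contains B
    because p is in U. *)
Lemma extend_subproof p : U p -> prime_ideal
  [set x : B | exists s a, [/\ ~ prime_set p s, iota s * x = iota a & prime_set p a]].
Proof.
move=> Up; have [[p0 pD pM] p1 pP] := prime_setP p.
have nM s t : ~ prime_set p s -> ~ prime_set p t -> ~ prime_set p (s * t).
  by move=> ps pt /pP[].
have iinj : injective iota by move=> a b E; apply: einj; rewrite -!v_iota E.
split.
- split=> [|x y [s [a [ps Ea pa]]] [t [b [pt Eb pb]]]|c x [s [a [ps Ea pa]]]].
  + by exists 1, 0; rewrite mulr0 rmorph0.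
  + exists (s * t), (t * a + s * b); split; [exact: nM| |by apply: (pD); exact: pM].
    by rewrite rmorphD !rmorphM -Ea -Eb; ring.
  + have /regularP /(_ p Up) [t [b [pt Eb]]] := valP c.
    have {}Eb : iota t * c = iota b by apply: vinj; rewrite rmorphM.
    exists (t * s), (b * a); split; [exact: nM| |exact: pM].
    by rewrite !rmorphM -Ea -Eb; ring.
- move=> [s [a [ps Ea pa]]]; apply: ps; suff -> : s = a by [].
  by apply: iinj; rewrite -Ea mulr1.
- move=> x y [s [a [ps Ea pa]]].
  have /regularP /(_ p Up) [t [b [pt Eb]]] := valP x.
  have /regularP /(_ p Up) [r [c [pr Ec]]] := valP y.
  have {}Eb : iota t * x = iota b by apply: vinj; rewrite rmorphM.
  have {}Ec : iota r * y = iota c by apply: vinj; rewrite rmorphM.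
  have /pP[/ps []|/pP[pb|pc]] : prime_set p (s * (b * c)).
  + have -> : s * (b * c) = t * r * a; last exact: pM.
    by apply: iinj; rewrite !rmorphM -Eb -Ec -Ea; ring.
  + by left; exists t, b.
  + by right; exists r, c.
Qed.

Lemma contract_onto p : U p -> exists q, contract q = p.
Proof.
move=> Up; exists (Spec (extend_subproof Up)); apply: spec_inj => /=.
have [[p0 pD pM] p1 pP] := prime_setP p.
apply/seteqP; split=> a /=; last first.
  by move=> pa; exists 1, a; split=> //; rewrite rmorph1 mul1r.
move=> [s [b [ps E pb]]]; have : prime_set p (s * a); last by move=> /pP[].
suff -> : s * a = b by [].
by apply: einj; rewrite rmorphM; exact: (congr1 v E).
Qed.

Lemma contract_continuous : continuous contract.
Proof.
apply/continuousP => _ [E ->]; exists (iota @` E); apply/seteqP; split=> q /= nE sub.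
  by apply: nE => a Ea; apply: sub; exists a.
by apply: nE => _ [a Ea <-]; exact: sub.
Qed.

Lemma contract_open (W : set (spec B)) : open W -> open (contract @` W).
Proof.
move=> [E ->].
pose E' := [set sa | exists s a x, [/\ E x, iota s * x = iota a & sa = s * a]].
rewrite (_ : _ @` _ = ~` zeros I `&` ~` zeros E').
  by apply: openI; [exists I|exists E'].
apply/seteqP; split=> [_ [q qE <-]|p [Up pE']].
  split=> [|E'q]; first exact: (@contract_in q).
  apply: qE => x Ex; have [s [a [qs Ea ->]]] := local_fraction q x.
  have : prime_set q (iota (s * a)) by apply: E'q; exists s, a, x.
  rewrite rmorphM; case: (prime_setP q) => _ _ qP.
  by move=> /qP[/qs|].
have [q qp] := contract_onto Up; exists q => // Eq; apply: pE' => _ [s [a [x [Ex Ea ->]]]].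
rewrite -qp /= rmorphM; case: (prime_setP q) => -[_ _ qM] _ _; apply: (qM).
by rewrite -Ea; apply: qM; exact: Eq.
Qed.

Lemma stalk_pullback (q : spec B) (x : stalk (contract q)) :
  exists y : stalk q, value v y = value e x.
Proof.
have [a [s ->]] := fracP x.
have sq : `[< ~ prime_set q (iota (sval s)) >] by apply/asboolP; exact: (@denomP _ _ s).
exists (mkfrac (iota a) (exist _ (iota (sval s)) sq : denom q)).
by rewrite (value_mkfrac vinj) (value_mkfrac einj).
Qed.

(** Only one map of stalks preserves values in [F], because [value] is injective; its
    compatibilities are therefore checked in [F]. *)
Definition stalk_map (q : spec B) (x : stalk (contract q)) : stalk q :=
  projT1 (cid (stalk_pullback x)).

Lemma value_stalk_map q (x : stalk (contract q)) : value v (stalk_map x) = value e x.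
Proof. by rewrite /stalk_map; case: cid. Qed.

Section Pullback.
Variable V : set (spec R).

Lemma pullback_subproof (g : sections V) :
  @locally_fraction B (contract @^-1` V) (fun q Vq => stalk_map (germ g Vq)).
Proof.
move=> q Vq; have [W [oW Wq [a [s gW]]]] := germP g Vq.
exists (contract @^-1` W); split=> //.
  by move/continuousP: contract_continuous; apply.
exists (iota a), (iota s) => r Vr Wr; have [sr E] := gW _ Vr Wr.
have sr' : `[< ~ prime_set r (iota s) >] by apply/asboolP; exact: (elimT (asboolP _) sr).
exists sr'; apply: (value_eq_mkfrac vinj).
by rewrite value_stalk_map E (value_mkfrac einj).
Qed.

Definition pullback (g : sections V) : sections (contract @^-1` V) :=
  Sections (pullback_subproof g).

Lemma pullback_zmod : zmod_morphism pullback.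
Proof.
move=> g h; apply: sections_eq => q Vq; apply: (value_inj vinj).
rewrite [LHS]value_stalk_map /= (valueD einj) (valueN einj) (valueD vinj) (valueN vinj).
by rewrite !value_stalk_map.
Qed.

Lemma pullback_monoid : monoid_morphism pullback.
Proof.
split=> [|g h]; apply: sections_eq => q Vq; apply: (value_inj vinj).
  by rewrite [LHS]value_stalk_map (value1 vinj) (value1 einj).
by rewrite [LHS]value_stalk_map /= (valueM einj) (valueM vinj) !value_stalk_map.
Qed.

Hypotheses (oV : open V) (VU : V `<=` U).

Lemma pullback_inj : injective pullback.
Proof.
move=> g h E; apply: sections_eq => p Vp; apply: (value_inj einj).
have [q qp] := contract_onto (VU Vp); move: Vp; rewrite -qp => Vq.
have := congr1 (fun s => value v (germ s (Vq : (contract @^-1` V) q))) E.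
by rewrite /= !value_stalk_map.
Qed.

(** By [localized], a fraction x / z over B with z outside q is also a / s with a, s in R and s
    outside q. Exactly one q lies over each p in V, so the germs of [f] determine germs over V. *)
Lemma pullback_onto (f : sections (contract @^-1` V)) : exists g, pullback g = f.
Proof.
have localized (q : spec B) x (z : B) : ~ prime_set q z -> exists a s,
    ~ prime_set q (iota s) /\ v x / v z = e a / e s.
  move=> qz; have [s [a [qs Es _]]] := local_fraction q x.
  have [t [b [qt Et qb]]] := local_fraction q z.
  have [_ _ qP] := prime_setP q.
  have qsb : ~ prime_set q (iota (s * b)) by rewrite rmorphM => /qP[//|/qb].
  exists (a * t), (s * b); split=> //.
  have vs : e s != 0 := nonzero_notin_prime vinj qs.
  have vt : e t != 0 := nonzero_notin_prime vinj qt.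
  have vz : v z != 0 := nonzero_notin_prime vinj qz.
  have Es' : e s * v x = e a := congr1 v Es.
  have Et' : e t * v z = e b := congr1 v Et.
  by rewrite !rmorphM -Es' -Et'; field; rewrite vz vt vs.
have germ_ex p (Vp : V p) : exists y : stalk p, forall q (Vq : (contract @^-1` V) q),
    contract q = p -> value e y = value v (germ f Vq).
  have [q qp] := contract_onto (VU Vp); move: Vp; rewrite -qp => Vq.
  have [x [z E]] := fracP (germ f (Vq : (contract @^-1` V) q)).
  have [a [s [qs Eas]]] := localized q x (sval z) (@denomP _ _ z).
  have sq : `[< ~ prime_set (contract q) s >] by apply/asboolP.
  exists (mkfrac a (exist _ s sq : denom (contract q))) => r Vr rq.
  have {}rq := contract_inj rq; rewrite rq in Vr *.
  rewrite (Prop_irrelevance Vr Vq) E (value_mkfrac einj) (value_mkfrac vinj).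
  by rewrite -Eas.
pose g p (Vp : V p) := projT1 (cid (germ_ex p Vp)).
have gE p (Vp : V p) q (Vq : (contract @^-1` V) q) :
    contract q = p -> value e (g p Vp) = value v (germ f Vq).
  by rewrite /g; case: cid => y /= yE; exact: yE.
have gP : locally_fraction g.
  move=> p Vp; have [q qp] := contract_onto (VU Vp).
  have Vq : (contract @^-1` V) q by rewrite /preimage /= qp.
  have [W [oW Wq [x [z fW]]]] := germP f Vq.
  have [qz _] := fW q Vq Wq.
  have [a [s [qs Eas]]] := localized q x z (@denomP _ _ (exist _ z qz : denom q)).
  exists (contract @` W `&` ~` zeros [set s]); split.
  - by apply: openI; [exact: contract_open|exists [set s]].
  - split; first by exists q.
    by move=> /(_ s erefl); rewrite -qp.
  - exists a, s => p' Vp' [[r Wr rp'] sp'].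
    have sp'' : `[< ~ prime_set p' s >] by apply/asboolP => ps; apply: sp' => _ ->.
    exists sp''; apply: (value_eq_mkfrac einj); rewrite -Eas.
    have Vr : (contract @^-1` V) r by rewrite /preimage /= rp'.
    rewrite (gE p' Vp' r Vr rp'); have [rz ->] := fW r Vr Wr.
    by rewrite (value_mkfrac vinj).
exists (Sections gP); apply: sections_eq => q Vq; apply: (value_inj vinj).
by rewrite [LHS]value_stalk_map; exact: gE.
Qed.

Lemma pullback_bij : bijective pullback.
Proof.
have [h hK] := choice pullback_onto.
by exists h => // g; apply: pullback_inj; rewrite hK.
Qed.

End Pullback.

Lemma unit_affine_complement : affine_open U.
Proof.
split; first by exists I.
exists B, contract, pullback; split.
- split; [exact: contract_inj| |exact: contract_continuous|exact: contract_open].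
  apply/seteqP; split=> [_ [q _ <-]|p Up]; first exact: (@contract_in q).
  by have [q qp] := contract_onto Up; exists q.
- move=> V oV VU; split; [exact: pullback_zmod|exact: pullback_monoid|exact: pullback_bij].
- move=> V W WV oV oW VU g; apply: sections_eq => q Wq /=.
  by congr (stalk_map (germ g _)); exact: Prop_irrelevance.
Qed.

End UnitAffine.

(** * The residual ideal *)

Lemma divides_coefs (A : comNzRingType) (d : A) (p : {poly A}) :
  (forall k, divides d p`_k) -> exists g, p = d%:P * g.
Proof.
move=> /choice[q pq]; exists (\poly_(k < size p) q k); apply/polyP => k.
rewrite coefCM coef_poly mulrC; case: ltnP => [_|sp]; first exact: pq.
by rewrite mul0r nth_default.
Qed.

(* Pseudo-division by an element f of minimal degree in I.                     *)
Lemma ideal_poly_quasi_principal (A : idomainType) (I : set {poly A}) (h0 : {poly A}) :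
  noetherian {poly A} -> ideal I -> I h0 -> h0 != 0 ->
  exists f d, [/\ I f, f != 0, d != 0 & forall h, I h -> divides f (d%:P * h)].
Proof.
move=> noeth idI Ih0 h00; have [I0 ID IM] := idI.
have ex_size : exists n, `[< exists f, [/\ I f, f != 0 & size f = n] >].
  by exists (size h0); apply/asboolP; exists h0.
case: (ex_minnP ex_size) => n /asboolP[f [If f0 sf]] minf; exists f.
set l := lead_coef f; have l0 : l != 0 by rewrite lead_coef_eq0.
have quasi h : I h -> exists N, divides f ((l ^+ N)%:P * h).
  move=> Ih; exists (scalp h f), (h %/ f)%R.
  have E := Pdiv.Idomain.divp_eq h f; rewrite -mul_polyC in E.
  suff r0 : h %% f = 0 by rewrite E r0 addr0.
  apply/eqP/negPn/negP => r0.
  have Ir : I (h %% f).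
    have -> : h %% f = (l ^+ scalp h f)%:P * h - (h %/ f) * f by rewrite E addrC addKr.
    by apply: idealB => //; exact: IM.
  have := minf (size (h %% f)); rewrite -sf leqNgt ltn_modp f0 => /(_ _)/negP; apply=> //.
  by apply/asboolP; exists (h %% f).
have [s Es] := noeth _ idI.
pose D N := [set h | divides f ((l ^+ N)%:P * h)].
have idD N : ideal (D N).
  split=> [|x y|a x]; rewrite /D /=.
  - by rewrite mulr0; exact: divides0.
  - by rewrite mulrDr; exact: dividesD.
  - by rewrite mulrCA; exact: dividesMl.
(* The exponent in [quasi] depends on h; adding up those of finitely many generators makes it
   uniform. *)
have [N sN] : exists N, forall h, h \in s -> D N h.
  have : forall h, h \in s -> I h by move=> h; rewrite Es; exact: mem_ideal_span.
  elim: (s) => [|h t IHt] tI; first by exists 0%N.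
  have [n1 tn] := IHt (fun g gt => tI g (mem_behead (s := h :: t) gt)).
  have [n2 hn] := quasi h (tI h (mem_head _ _)).
  exists (n1 + n2)%N => g; rewrite inE /D /= exprD polyCM => /orP[/eqP ->|/tn Dg].
    by rewrite -mulrA; exact: dividesMl.
  by rewrite mulrAC mulrC; apply: dividesMl.
exists (l ^+ N); split=> //; first exact: expf_neq0.
by move=> h; rewrite Es; exact: ideal_span_sub (idD N) sN h.
Qed.

(** * Transfer of affineness from Spec A to Spec A[T] *)

Section Main.
Variable A : idomainType.
Hypothesis noeth : noetherian A.
Hypothesis cic : completely_integrally_closed A.
Hypothesis haff : forall H : set (spec A), hypersurface H -> affine_open (~` H).

Let T : idomainType := {poly A}.
Variables (F : fieldType) (e : {rmorphism T -> F}).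
Hypothesis einj : injective e.
Let eA : {rmorphism A -> F} := (e \o polyC).

Let eAinj : injective eA.
Proof. by move=> a b /einj /polyC_inj. Qed.

Section Residual.
Variables (I : set {poly A}) (f : {poly A}) (d : A).
Hypotheses (f0 : f != 0) (d0 : d != 0).
Hypothesis dI : forall h, I h -> divides f (d%:P * h).

(* C = (f : I) and I' = (f : C), the reflexive hull of I.                      *)
Let C : set {poly A} := [set r | forall h, I h -> divides f (r * h)].
Let I' : set {poly A} := [set h | forall r, C r -> divides f (h * r)].
Let U' := ~` zeros (I' : set T).
Let J' := ideal_gen (@coord_cst T F e U' @` I').

Let Cf : C f. Proof. by move=> h _; apply: dividesMr; exact: divides_refl. Qed.
Let Cd : C d%:P. Proof. exact: dI. Qed.

Section Coefficient.
Variable c : A.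
Hypotheses (c0 : c != 0) (cf : exists i, c = f`_i).

Let Z : set A := [set z | exists r j, C r /\ z = r`_j].
Let a : set A := [set b | forall z, Z z -> divides c (b * z)].

Let cP0 : c%:P != 0 :> {poly A}. Proof. by rewrite polyC_eq0. Qed.
Let dP0 : d%:P != 0 :> {poly A}. Proof. by rewrite polyC_eq0. Qed.

(** Write h d = w f. For r in C, f divides h r, so d divides the coefficients of w r and, by
    [divides_content], every w_k r_j. Taking r = f gives a polynomial g = c w / d; a general r then
    shows that c divides every g_k r_j. *)
Lemma residual_factor (h : {poly A}) : I' h ->
  exists g : {poly A}, c%:P * h = f * g /\ forall k, a g`_k.
Proof.
move=> Ih; have [w Ew] := Ih _ Cd.
have dw r j k : C r -> divides d (w`_k * r`_j).
  move=> Cr; have [g Eg] := Ih _ Cr.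
  apply: divides_content => // l.
  suff -> : w * r = d%:P * g by rewrite coefCM; apply: dividesMr; exact: divides_refl.
  by apply: (mulIf f0); rewrite mulrAC -Ew -mulrA [_ * r]mulrC mulrA Eg; ring.
have [i Ec] := cf.
have [g Eg] : exists g, c%:P * w = d%:P * g.
  by apply: divides_coefs => k; rewrite coefCM mulrC Ec; exact: dw.
exists g; split.
  by apply: (mulIf dP0); rewrite -mulrA Ew mulrA Eg; ring.
move=> k _ [r [j [Cr ->]]]; have [q Eq] := dw r j k Cr; exists q.
apply: (mulIf d0).
have Ek : c * w`_k = d * g`_k by rewrite -!coefCM Eg.
by rewrite mulrAC [g`_k * d]mulrC -Ek -mulrA Eq; ring.
Qed.

Lemma residual_multiple (b : A) : a b -> exists2 h, I' h & c%:P * h = b%:P * f.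
Proof.
move=> ab; have [h Eh] : exists h, b%:P * f = c%:P * h.
  by apply: divides_coefs => k; rewrite coefCM; apply: ab; exists f, k.
exists h => // r Cr.
have [g Eg] : exists g, b%:P * r = c%:P * g.
  by apply: divides_coefs => k; rewrite coefCM; apply: ab; exists r, k.
exists g; apply: (mulfI cP0).
by rewrite mulrA -Eh mulrAC Eg; ring.
Qed.

Let gamma : F := e c%:P / e f.
Let ef0 : e f != 0. Proof. by rewrite raddf_eq0. Qed.
Let ec0 : e c%:P != 0. Proof. by rewrite raddf_eq0. Qed.

Let gammaE (h g : {poly A}) : c%:P * h = f * g -> e h * gamma = e g.
Proof.
move=> E; apply: (mulfI ef0); rewrite -rmorphM -E rmorphM /gamma.
by rewrite mulrCA [e f * _]mulrC divfK // mulrC.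
Qed.

Let outside (q : spec T) : U' q -> exists h, I' h /\ ~ prime_set q h.
Proof.
move=> Uq; apply: contrapT => no; apply: Uq => h Ih; apply: contrapT => qh.
by apply: no; exists h.
Qed.

Let gamma_regular : gamma \in regular e U'.
Proof.
apply/regularP => q /outside[h [Ih qh]]; have [g [E _]] := residual_factor Ih.
by exists h, g; split=> //; exact: gammaE.
Qed.

Let Ua := ~` zeros a.

Let ida : ideal a.
Proof.
split=> [z _|x y ax ay z Zz|u x ax z Zz].
- by rewrite mul0r; exact: divides0.
- by rewrite mulrDl; apply: dividesD; [exact: ax|exact: ay].
- by rewrite -mulrA; apply: dividesMl; exact: ax.
Qed.

(** By [prime_avoiding] each element of a has a power clearing the denominators of y, and by
    [span_pow] one exponent n serves all of a[T]. For h in I', gamma = g / h with g in a[T], so h^n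
    is a denominator of y gamma^n. *)
Let regular_gammaX (y : coord_ring eA Ua) :
  exists n, \val y * gamma ^+ n \in regular e U'.
Proof.
pose D : set {poly A} := [set p | exists b, e p * \val y = e b].
have idD : ideal D.
  split=> [|p q [b Eb] [b' Eb']|p q [b Eb]].
  - by exists 0; rewrite !rmorph0 mul0r.
  - by exists (b + b'); rewrite !rmorphD mulrDl Eb Eb'.
  - by exists (p * b); rewrite !rmorphM -Eb mulrA.
pose d' : set A := [set x | D x%:P].
have idd' : ideal d'.
  have [D0 DD DM] := idD.
  by split=> [|x x'|x x']; rewrite /d' /= ?polyC0 ?polyCD ?polyCM //; [exact: DD|exact: DM].
have rad b : a b -> exists n, d' (b ^+ n).
  move=> ab; apply: contrapT => no.
  have [n|p [d'p pb]] := @prime_avoiding _ d' b idd'.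
    by move=> db; apply: no; exists n.
  have Up : Ua p by move=> /(_ _ ab).
  have /regularP /(_ p Up) [s [x [ps Ex]]] := valP y.
  by apply: ps; apply: d'p; exists x%:P.
have [s Es] := noeth ida.
have [|n sn] := @span_pow _ D idD (map polyC s).
  move=> _ /mapP[b /mem_ideal_span + ->]; rewrite -Es => /rad[n].
  by rewrite /d' /= polyC_exp; exists n.
exists n; apply/regularP => q /outside[h [Ih qh]].
have [g [E ag]] := residual_factor Ih.
have Dg : D (g ^+ n).
  have [S0 SD SM] := ideal_spanP (map (@polyC A) s : seq T).
  apply: sn; rewrite -[g]coefK poly_def; apply: ideal_sum; first exact: ideal_spanP.
  move=> k _; rewrite -mul_polyC mulrC; apply: (SM).
  have idS : ideal [set x : A | ideal_span (map (@polyC A) s : seq T) x%:P].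
    by split=> [|x x'|x x']; rewrite /= ?polyC0 ?polyCD ?polyCM //; [exact: SD|exact: SM].
  apply: (ideal_span_sub idS (s := s)); last by rewrite -Es; exact: ag.
  by move=> x xs; apply: mem_ideal_span; exact: map_f.
have [b Eb] := Dg; exists (h ^+ n), b; split; first by move=> /(primeX (prime_setP q)).
by rewrite -Eb !rmorphXn mulrCA -exprMn (gammaE E) mulrC.
Qed.

(** The y in O(D(a)) with some y gamma^n in [J'] form an ideal [L], by [regular_gammaX]. It contains
    a: if c h = b f with h in I', then b gamma = gamma^2 h. As D(a) is affine, 1 lies in [L]. *)
Lemma ratio_radical : exists x : coord_ring e U',
  \val x = e c%:P / e f /\ exists n, J' (x ^+ n).
Proof.
pose g : coord_ring e U' := CoordRing gamma_regular; exists g; split=> //.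
have ac : a c by move=> z _; apply: dividesMr; exact: divides_refl.
have unit := affine_complement_unit eAinj ac c0
  (haff (colon_hypersurface Z noeth cic c0)).
have idJ : ideal J' by exact: ideal_genP.
have [J0 JD JM] := idJ.
pose L : set (coord_ring eA Ua) :=
  [set x | exists n z, J' z /\ \val x * gamma ^+ n = \val z].
have [|b [x ax <-]|n [z [Jz E]]] := unit L.
- split=> [|x y [n [z [Jz Ez]]] [m [w [Jw Ew]]]|y x [n [z [Jz Ez]]]].
  + by exists 0%N, 0; split=> //; rewrite !rmorph0 mul0r.
  + exists (n + m)%N, (g ^+ m * z + g ^+ n * w).
    split; first by apply: (JD); exact: JM.
    rewrite !coord_valD !coord_valM !coord_valX -Ez -Ew exprD mulrDl.
    by congr (_ + _); [rewrite [RHS]mulrC mulrA|rewrite mulrCA].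
  + have [m my] := regular_gammaX y.
    exists (m + n)%N, (CoordRing my * z); split; first exact: JM.
    by rewrite !coord_valM -Ez exprD mulrACA.
- have [h Ih Eh] := residual_multiple ax.
  exists 1%N, (g ^+ 2 * coord_cst e U' h); split.
    by apply: JM; apply: sub_ideal_gen; exists h.
  have {}Eh : e c%:P * e h = e x%:P * e f by rewrite -!rmorphM Eh.
  rewrite coord_valM coord_valX expr1 /= expr2 -mulrA.
  suff -> : gamma * e h = e x%:P by rewrite mulrC.
  by rewrite /gamma mulrAC Eh mulfK.
exists n; suff -> : g ^+ n = z by [].
by apply: val_inj; rewrite coord_valX -E rmorph1 mul1r.
Qed.

End Coefficient.

(** Dividing f = sum of f_i X^i by f writes 1 as a combination of the ratios f_i / f, each with a
    power in [J']; by [span_pow] a power of 1 lies in [J']. *)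
Lemma residual_affine : affine_open U'.
Proof.
apply: (unit_affine_complement einj).
have idJ : ideal J' by exact: ideal_genP.
have /choice[x xP] : forall i, exists x : coord_ring e U',
    \val x = e (f`_i)%:P / e f /\ exists n, J' (x ^+ n).
  move=> i; have [fi|fi] := eqVneq f`_i 0; last by apply: ratio_radical => //; exists i.
  exists 0; split; first by rewrite fi !rmorph0 mul0r.
  by exists 1%N; rewrite expr1; case: idJ.
have [|n Jn] := @span_pow _ J' idJ [seq x i | i <- iota 0 (size f)].
  by move=> _ /mapP[i _ ->]; case: (xP i).
rewrite -(expr1n _ n); apply: Jn.
have ef0 : e f != 0 by rewrite raddf_eq0.
have -> : 1 = \sum_(i < size f) x i * coord_cst e U' 'X^i.
  apply: val_inj; rewrite rmorph1 rmorph_sum /=.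
  apply: (mulIf ef0); rewrite mul1r mulr_suml.
  rewrite -{1}[f]coefK poly_def rmorph_sum; apply: eq_bigr => i _.
  by rewrite (xP i).1 -mul_polyC rmorphM mulrAC divfK.
apply: ideal_sum => [|i _]; first exact: ideal_spanP.
rewrite mulrC; have [_ _ SM] := ideal_spanP [seq x i | i <- iota 0 (size f)].
by apply: SM; apply: mem_ideal_span; apply: map_f; rewrite mem_iota /= ltn_ord.
Qed.

End Residual.

Lemma poly_hypersurface_affine (H : set (spec T)) : hypersurface H -> affine_open (~` H).
Proof.
move=> hypH; have [clH _] := hypH.
have noethT : noetherian T := noetherian_poly noeth.
pose I := vanishing H; have idI : ideal I := vanishing_ideal H.
(* Otherwise the generic point would lie in H, and a height one prime would be contained in the zero
   ideal. *)
have [h0 [Ih0 h00]] : exists h, I h /\ h != 0.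
  apply: contrapT => no.
  have Hg : H (generic_point T).
    rewrite -(zeros_vanishing clH) => h Ih; apply/eqP/negPn/negP => h0.
    by apply: no; exists h.
  have [q [qg _ [[x qx x0] _]]] := hypersurface_component hypH Hg.
  by move/qg: qx x0 => /= ->; rewrite eqxx.
have [f [d [If f0 d0 dI]]] := ideal_poly_quasi_principal noethT idI Ih0 h00.
suff <- : zeros [set h | forall r : T, (forall g, I g -> divides f (r * g)) ->
                     divides f (h * r)] = H.
  exact: residual_affine f0 d0 dI.
apply/seteqP; split=> p.
  move=> sub; rewrite -(zeros_vanishing clH) => h Ih; apply: sub => r rI.
  by rewrite mulrC; exact: rI.
move=> Hp; have [q [qp Iq [_ qht]]] := hypersurface_component hypH Hp.
have fq : prime_set q f by exact: Iq.
pose J := [set h : T | divides f h].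
have idJ : ideal J.
  by split=> [|x y|x y]; [exact: divides0|exact: dividesD|exact: dividesMl].
have [||y qy] := @minimal_prime_colon _ J q noethT idJ.
- by move=> h [g ->]; have [[_ _ qM] _ _] := prime_setP q; exact: qM.
- by move=> q' Jq' q'q; apply: (qht q' f) => //; apply: Jq'; exact: divides_refl.
(* Since I lies in q = (f : y), y belongs to (f : I); hence f divides h y, and h lies in q. *)
move=> h hI'; apply: qp; apply/qy/hI' => g Ig.
by rewrite mulrC; apply/qy/Iq.
Qed.

End Main.

Theorem corollary2p7 (A : idomainType)
    (hnoeth : noetherian A) (hnormal : normal_domain A)
    (haff : forall H : set (spec A), hypersurface H -> affine_open (~` H)) :
  forall H : set (spec {poly A}), hypersurface H -> affine_open (~` H).
Proof.
have tofrac_inj : injective (@tofrac {poly A}).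
  by move=> p q /eqP; rewrite tofrac_eq => /eqP.
exact: poly_hypersurface_affine hnoeth (noetherian_normal_cic hnoeth hnormal)
  haff _ _ tofrac_inj.
Qed.
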